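(* Let $m\in\mathbb{N}$, $m>1$, and let $d=2m$. Let $(G_n)_{n\ge m+1}$ be the uniform attachment random graph process with parameters $m$ and $d=2m$ (defined in the context). Then $G_n$ obeys the first-order convergence law: for every first-order sentence $\varphi$ in the language of graphs, the probability $\Pr(G_n\models\varphi)$ converges as $n\to\infty$.
   Context: The random graph process: fix $m\in\mathbb{N}$ with $m>1$ and put $d=2m$. Start with $G_{m+1}$, the complete graph on the vertex set $\{1,\dots,m+1\}$. For each $n\ge m+1$, given $G_n$ (a simple graph on $\{1,\dots,n\}$), the graph $G_{n+1}$ is obtained by adding the vertex $n+1$ together with $m$ edges joining it to $m$ different vertices, chosen uniformly at random among those vertices of $\{1,\dots,n\}$ whose degree in $G_n$ is less than $d$ (i.e. the set of $m$ chosen vertices is a uniformly random $m$-element subset of the set of vertices of degree less than $d$ in $G_n$, the choice depending on the past only through $G_n$). There are always at least $m+1$ vertices of degree less than $d$ in $G_n$, so the process is well defined. First-order sentences about graphs are the closed formulas built from variables (representing vertices), the logical connectives $\wedge,\vee,\neg,\Rightarrow,\Leftrightarrow$, the two binary relation symbols $\sim$ (adjacency) and $=$ (equality), brackets, and the quantifiers $\exists,\forall$ over vertices. $G\models\varphi$ means that $\varphi$ is true on the graph $G$. *)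

(* Defs.v *)
From HB Require Import structures.
From mathcomp Require Import all_boot all_order all_algebra.
Set Implicit Arguments.
Unset Strict Implicit.
Unset Printing Implicit Defensive.

Definition simple_rel (n : nat) (e : {ffun 'I_n * 'I_n -> bool}) : bool :=
  [forall x, ~~ e (x, x)] && [forall x, forall y, e (x, y) == e (y, x)].

(* The vertices 1, ..., n are represented by 0, ..., n - 1 : 'I_n. *)
Record sgraph (n : nat) := SGraph {
  sg_edge : {ffun 'I_n * 'I_n -> bool};
  sg_simple : simple_rel sg_edge }.

HB.instance Definition _ n := [isSub for @sg_edge n].
HB.instance Definition _ n := [Finite of sgraph n by <:].

Definition adj (n : nat) (G : sgraph n) : rel 'I_n :=
  fun x y => sg_edge G (x, y).

Definition degree (n : nat) (G : sgraph n) (x : 'I_n) : nat :=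
  #|[set y | adj G x y]|.

Lemma complete_simple (n : nat) :
  simple_rel [ffun p : 'I_n * 'I_n => p.1 != p.2].
Proof.
apply/andP; split; first by apply/forallP => x; rewrite ffunE /= eqxx.
by apply/forallP => x; apply/forallP => y; rewrite !ffunE /= (eq_sym x).
Qed.

Definition complete_graph (n : nat) : sgraph n := SGraph (complete_simple n).

(* [unlift ord_max u] is [None] if u is the new vertex n of 'I_n.+1, and
   [Some x] if u is the old vertex x : 'I_n. *)
Definition attach_rel (n : nat) (G : sgraph n) (S : {set 'I_n}) :
    {ffun 'I_n.+1 * 'I_n.+1 -> bool} :=
  [ffun p => match unlift ord_max p.1, unlift ord_max p.2 with
             | Some x, Some y => adj G x y
             | Some x, None => x \in S
             | None, Some y => y \in S
             | None, None => false
             end].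

Lemma attach_simple (n : nat) (G : sgraph n) (S : {set 'I_n}) :
  simple_rel (attach_rel G S).
Proof.
case/andP: (sg_simple G) => /forallP irr /forallP sym.
apply/andP; split.
  apply/forallP => x; rewrite ffunE /=.
  by case: (unlift _ x) => [y|] //; apply: irr.
apply/forallP => x; apply/forallP => y; rewrite !ffunE /=.
case: (unlift _ x) => [u|]; case: (unlift _ y) => [v|] //.
by have /forallP := sym u; apply.
Qed.

Definition attach (n : nat) (G : sgraph n) (S : {set 'I_n}) : sgraph n.+1 :=
  SGraph (attach_simple G S).

Definition choices (m d n : nat) (G : sgraph n) : {set {set 'I_n}} :=
  [set S : {set 'I_n} |
    (S \subset [set x | (degree G x < d)%N]) && (#|S| == m)].

(* First-order formulas with k free variables, in de Bruijn form: a quantifier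
   binds the variable 0 of its body and shifts the others by one. *)
Inductive formula : nat -> Type :=
| FAdj k (i j : 'I_k) : formula k
| FEq k (i j : 'I_k) : formula k
| FNot k (f : formula k) : formula k
| FAnd k (f g : formula k) : formula k
| FOr k (f g : formula k) : formula k
| FImp k (f g : formula k) : formula k
| FIff k (f g : formula k) : formula k
| FEx k (f : formula k.+1) : formula k
| FAll k (f : formula k.+1) : formula k.

Definition sentence : Type := formula 0.

Definition env_cons (V : Type) (k : nat) (x : V) (e : 'I_k -> V) :
    'I_k.+1 -> V :=
  fun i => if unlift ord0 i is Some j then e j else x.

Fixpoint holds (V : Type) (E : rel V) (k : nat) (f : formula k) :
    ('I_k -> V) -> Prop :=
  match f in formula k return ('I_k -> V) -> Prop with
  | FAdj _ i j => fun e => E (e i) (e j)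
  | FEq _ i j => fun e => e i = e j
  | FNot _ f => fun e => ~ holds E f e
  | FAnd _ f g => fun e => holds E f e /\ holds E g e
  | FOr _ f g => fun e => holds E f e \/ holds E g e
  | FImp _ f g => fun e => holds E f e -> holds E g e
  | FIff _ f g => fun e => holds E f e <-> holds E g e
  | FEx _ f => fun e => exists x : V, holds E f (env_cons x e)
  | FAll _ f => fun e => forall x : V, holds E f (env_cons x e)
  end.

Definition no_vars (V : Type) (i : 'I_0) : V :=
  False_rect V (notF (ltn_ord i)).

Definition models (n : nat) (G : sgraph n) (phi : sentence) : Prop :=
  holds (adj G) phi (@no_vars 'I_n).

(* Loaded only here, so that [set x | _] above is a finite {set _}; from here on
   it is a classical set. *)
From mathcomp Require Import all_classical all_reals all_analysis.

Local Open Scope classical_set_scope.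

Definition history (T : Type) (G : forall n : nat, T -> sgraph n) (m n : nat)
    (g : forall i : nat, sgraph i) : set T :=
  [set w | forall i : nat, (m < i <= n)%N -> G i w = g i].

(* Only the graphs [G n] with n >= m + 1 matter.  The last field says that,
   conditionally on the past (G_{m+1}, ..., G_n) = (g_{m+1}, ..., g_n), each
   of the admissible sets S is the set of neighbours of the new vertex with
   the same probability 1 / #|choices m d (g n)|; these probabilities add up
   to 1, so that almost surely no other transition occurs. *)
Record uniform_attachment (R : realType) (disp : measure_display)
    (T : measurableType disp) (P : probability T R)
    (G : forall n : nat, T -> sgraph n) (m d : nat) : Prop :=
  UniformAttachment {
  ua_measurable : forall (n : nat) (g : sgraph n),
    (m < n)%N -> measurable [set w | G n w = g];
  ua_start : forall w : T, G m.+1 w = complete_graph m.+1;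
  ua_step : forall (n : nat) (g : forall i : nat, sgraph i) (S : {set 'I_n}),
    (m < n)%N -> S \in choices m d (g n) ->
    P (history G m n g `&` [set w | G n.+1 w = attach (g n) S]) =
    (P (history G m n g) * ((#|choices m d (g n)|%:R : R)^-1)%R%:E)%E }.

(* Main.v *)
(* At each step the sum of [2 * m - degree] over all vertices keeps its initial
   value m(m+1), so at most m(m+1) vertices are open (of degree < 2m).  By an
   Ehrenfeucht-Fraisse argument the rank-k type of (G_n, open vertices) and the
   degrees of the open vertices determine the law of the same data for
   G_{n+1}: they form a Markov chain on a finite set, and the state determines
   whether a sentence of rank k holds.

   The law of a finite chain converges as soon as from every state some state
   can be reached both in N and in N + 1 steps.  To check this, let the process
   continue from any graph in such a way that, after a transitory part that
   saturates all the old vertices, the new vertex v is always joined to v - 2,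
   v - 4, ..., v - 2m (these offsets sum to m(m+1), as they must).  This tail
   has period 1, so that, far from both of its ends, one vertex can be inserted
   without changing the rank-k type.

   For the chain, let Q be its transition matrix.  Iterating the hypothesis,
   from every state some state is reached in N, N + 1, ..., N + J steps, with
   probabilities at least d > 0.  Averaging over these J + 1 times, the parts of
   Q^(N+J)(Q-1)f carried by that state telescope to O(d / J), whence
   Q^t (Q-1) -> 0.  Thus ker (Q-1) and im (Q-1) are complementary, and
   mu Q^t converges. *)
Require Import Defs.
From mathcomp Require Import all_boot all_order all_algebra zify lra.
From mathcomp Require boolp.
Set Implicit Arguments.
Unset Strict Implicit.
Unset Printing Implicit Defensive.

(** * Types of bounded quantifier rank *)

Definition atomic (b : nat) : finType := {ffun 'I_b * 'I_b -> bool * bool}.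

(** Types are iterated finite sets instead of sets of formulas: that there are finitely many of each
    rank, hence finitely many states, then holds by construction. *)
Fixpoint fo_type (k b : nat) : finType :=
  if k is k'.+1 then (atomic b * {set fo_type k' b.+1})%type else atomic b.

Definition atp (V : finType) (E : rel V) (b : nat) (e : 'I_b -> V) : atomic b :=
  [ffun p => (E (e p.1) (e p.2), e p.1 == e p.2)].

Fixpoint tp (V : finType) (E : rel V) (k b : nat) {struct k} :
    ('I_b -> V) -> fo_type k b :=
  match k with
  | k'.+1 => fun e => (atp E e, [set tp E k' (env_cons x e) | x : V])
  | 0 => fun e => atp E e
  end.

Section Types.
Variables (V V' : finType) (E : rel V) (E' : rel V').

Lemma tp_atp k b (e : 'I_b -> V) (e' : 'I_b -> V') :
  tp E k e = tp E' k e' -> atp E e = atp E' e'.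
Proof. by case: k => [|k] //= [? _]. Qed.

Lemma atp_adj b (e : 'I_b -> V) (e' : 'I_b -> V') i j :
  atp E e = atp E' e' -> E (e i) (e j) = E' (e' i) (e' j).
Proof. by move=> /ffunP/(_ (i, j)); rewrite !ffunE => -[]. Qed.

Lemma atp_eq b (e : 'I_b -> V) (e' : 'I_b -> V') i j :
  atp E e = atp E' e' -> (e i == e j) = (e' i == e' j).
Proof. by move=> /ffunP/(_ (i, j)); rewrite !ffunE => -[]. Qed.

Lemma tp_forth k b (e : 'I_b -> V) (e' : 'I_b -> V') x :
  tp E k.+1 e = tp E' k.+1 e' ->
  exists y, tp E k (env_cons x e) = tp E' k (env_cons y e').
Proof.
move=> /= [_ eqS]; have: tp E k (env_cons x e) \in
    [set tp E k (env_cons z e) | z : V] by apply: imset_f.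
by rewrite eqS => /imsetP[y _ ->]; exists y.
Qed.

(** The Ehrenfeucht-Fraisse principle: [Z] is a winning strategy for the second player, [k] being
    the number of rounds left. The arity [b] varies, since each round adds a pebble. *)
Lemma tp_bf (Z : forall k b, ('I_b -> V) -> ('I_b -> V') -> Prop) :
  (forall k b e e', Z k b e e' -> atp E e = atp E' e') ->
  (forall k b e e', Z k.+1 b e e' ->
     forall x, exists y, Z k b.+1 (env_cons x e) (env_cons y e')) ->
  (forall k b e e', Z k.+1 b e e' ->
     forall y, exists x, Z k b.+1 (env_cons x e) (env_cons y e')) ->
  forall k b e e', Z k b e e' -> tp E k e = tp E' k e'.
Proof.
move=> Zat Zforth Zback; elim=> [|k IHk] b e e' Zee'; first exact: Zat Zee'.
rewrite /=; congr pair; first exact: Zat Zee'.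
apply/setP => t; apply/imsetP/imsetP => -[z _ ->].
  by have [y Zy] := Zforth _ _ _ _ Zee' z; exists y => //; apply: IHk.
by have [x Zx] := Zback _ _ _ _ Zee' z; exists x => //; apply/esym/IHk.
Qed.

End Types.

Section TypesTheory.
Variables (V V' : finType) (E : rel V) (E' : rel V').

Lemma tp_back k b (e : 'I_b -> V) (e' : 'I_b -> V') y :
  tp E k.+1 e = tp E' k.+1 e' ->
  exists x, tp E k (env_cons x e) = tp E' k (env_cons y e').
Proof. by move=> /esym/(tp_forth y)[x eq_xy]; exists x. Qed.

Lemma tp_pred k b (e : 'I_b -> V) (e' : 'I_b -> V') :
  tp E k.+1 e = tp E' k.+1 e' -> tp E k e = tp E' k e'.
Proof.
move: k b e e'.
apply: (tp_bf (Z := fun k b e e' => tp E k.+1 e = tp E' k.+1 e')).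
- by move=> k b e e' /tp_atp.
- by move=> k b e e' /tp_forth.
- by move=> k b e e' h y; apply: tp_back.
Qed.

Lemma env_cons0 (T : Type) b (x : T) (e : 'I_b -> T) : env_cons x e ord0 = x.
Proof. by rewrite /env_cons unlift_none. Qed.

Lemma env_consS (T : Type) b (x : T) (e : 'I_b -> T) i :
  env_cons x e (lift ord0 i) = e i.
Proof. by rewrite /env_cons liftK. Qed.

Lemma env_consP (T : Type) b (f : 'I_b.+1 -> T) (x : T) (e : 'I_b -> T) :
  f ord0 = x -> (forall i, f (lift ord0 i) = e i) -> f = env_cons x e.
Proof.
move=> f0 fS; apply: boolp.funext => i.
by case: (unliftP ord0 i) => [j|] ->; rewrite ?env_cons0 ?env_consS.
Qed.

(** The second player answers as in the game on the longer tuples, which the invariant keeps hidden;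
    each new pebble is put at position 0 of both, and [r] is extended accordingly. *)
Lemma tp_reindex k b c (e : 'I_b -> V) (e' : 'I_b -> V') (r : 'I_c -> 'I_b) :
  tp E k e = tp E' k e' -> tp E k (e \o r) = tp E' k (e' \o r).
Proof.
move=> eq_ee'.
apply: (tp_bf (Z := fun k c f f' => exists b (e : 'I_b -> V) e' r,
  [/\ tp E k e = tp E' k e', f = e \o r & f' = e' \o r])); last first.
- by exists b, e, e', r.
- move=> {b c e e' r eq_ee'} {}k c f f' [b [e [e' [r [eq_ee' -> ->]]]]] y.
  have [x eqxy] := tp_back y eq_ee'; exists x.
  exists b.+1, (env_cons x e), (env_cons y e').
  exists (env_cons ord0 (lift ord0 \o r)); split=> //;
    by apply/esym/env_consP => [|i] /=; rewrite ?env_cons0 ?env_consS //=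
      env_consS.
- move=> {b c e e' r eq_ee'} {}k c f f' [b [e [e' [r [eq_ee' -> ->]]]]] x.
  have [y eqxy] := tp_forth x eq_ee'; exists y.
  exists b.+1, (env_cons x e), (env_cons y e').
  exists (env_cons ord0 (lift ord0 \o r)); split=> //;
    by apply/esym/env_consP => [|i] /=; rewrite ?env_cons0 ?env_consS //=
      env_consS.
- move=> {b c e e' r eq_ee'} {}k c f f' [b [e [e' [r [/tp_atp eq_ee' -> ->]]]]].
  by apply/ffunP => -[i j]; rewrite !ffunE /=
    (atp_adj _ _ eq_ee') (atp_eq _ _ eq_ee').
Qed.

End TypesTheory.

Fixpoint qrank (k : nat) (f : formula k) : nat :=
  match f with
  | FAdj _ _ _ | FEq _ _ _ => 0
  | FNot _ f => qrank f
  | FAnd _ f g | FOr _ f g | FImp _ f g | FIff _ f g => maxn (qrank f) (qrank g)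
  | FEx _ f | FAll _ f => (qrank f).+1
  end.

Lemma tp_holds (V V' : finType) (E : rel V) (E' : rel V') b (f : formula b) k
    (e : 'I_b -> V) (e' : 'I_b -> V') :
  qrank f <= k -> tp E k e = tp E' k e' -> holds E f e <-> holds E' f e'.
Proof.
elim: f k e e' => {b} [b i j|b i j|b f IHf|b f IHf g IHg|b f IHf g IHg
  |b f IHf g IHg|b f IHf g IHg|b f IHf|b f IHf] k e e' /=.
- by move=> _ /tp_atp eqe; rewrite (atp_adj _ _ eqe).
- move=> _ /tp_atp eqe; split=> /eqP h; apply/eqP; move: h;
    by rewrite (atp_eq _ _ eqe).
- by move=> lek /(IHf _ _ _ lek) ->.
- by rewrite geq_max => /andP[/IHf hf /IHg hg] h; rewrite (hf _ _ h) (hg _ _ h).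
- by rewrite geq_max => /andP[/IHf hf /IHg hg] h; rewrite (hf _ _ h) (hg _ _ h).
- by rewrite geq_max => /andP[/IHf hf /IHg hg] h; rewrite (hf _ _ h) (hg _ _ h).
- by rewrite geq_max => /andP[/IHf hf /IHg hg] h; rewrite (hf _ _ h) (hg _ _ h).
- case: k => // k lek h; split=> -[z hz].
    by have [y /(IHf _ _ _ lek) hy] := tp_forth z h; exists y; apply/hy.
  by have [x /(IHf _ _ _ lek) hx] := tp_back z h; exists x; apply/hx.
- case: k => // k lek h; split=> hz z.
    by have [x /(IHf _ _ _ lek) hx] := tp_back z h; apply/hx.
  by have [y /(IHf _ _ _ lek) hy] := tp_forth z h; apply/hy.
Qed.

(** Reindexing along the empty map forgets all the marked vertices, and a sentence has no free
    variable. *)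
Lemma tp_models k b n n' (G : sgraph n) (H : sgraph n') phi
    (e : 'I_b -> 'I_n) (e' : 'I_b -> 'I_n') :
  qrank phi <= k -> tp (adj G) k e = tp (adj H) k e' ->
  models G phi <-> models H phi.
Proof.
move=> lek /(@tp_reindex _ _ _ _ k b 0 _ _ (@no_vars 'I_b)) eqt.
have no_varsE (T : Type) (f : 'I_0 -> T) : f = @no_vars T.
  by apply: boolp.funext => -[].
rewrite /models -(no_varsE _ (e \o @no_vars 'I_b)).
rewrite -(no_varsE _ (e' \o @no_vars 'I_b)).
exact: tp_holds eqt.
Qed.

(** * The state of the process *)

Section Attach.
Variables (n : nat) (G : sgraph n) (S : {set 'I_n}).

Lemma adj_irr x : adj G x x = false.
Proof. by have /andP[/forallP/(_ x)/negbTE] := sg_simple G. Qed.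

Lemma adj_sym x y : adj G x y = adj G y x.
Proof. by have /andP[_ /forallP/(_ x)/forallP/(_ y)/eqP] := sg_simple G. Qed.

Lemma adj_attach_lift x y :
  adj (attach G S) (lift ord_max x) (lift ord_max y) = adj G x y.
Proof. by rewrite /adj ffunE /= !liftK. Qed.

Lemma adj_attach_max x : adj (attach G S) (lift ord_max x) ord_max = (x \in S).
Proof. by rewrite /adj ffunE /= liftK unlift_none. Qed.

Lemma degreeE (x : 'I_n) : degree G x = \sum_y (adj G x y : nat).
Proof.
rewrite /degree -sum1_card big_mkcond; apply: eq_bigr => y _.
by rewrite inE; case: (adj G x y).
Qed.

End Attach.

Lemma widen_lift n (x : 'I_n) : widen_ord (leqnSn n) x = lift ord_max x.
Proof. by apply: val_inj; rewrite /= /bump leqNgt ltn_ord. Qed.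

Lemma big_ord_lift (n : nat) (F : 'I_n.+1 -> nat) :
  \sum_(i < n.+1) F i = \sum_(i < n) F (lift ord_max i) + F ord_max.
Proof.
by rewrite big_ord_recr /=; congr addn; apply: eq_bigr => i _; rewrite widen_lift.
Qed.

Lemma attach_inj n (G : sgraph n) : injective (attach G).
Proof.
move=> S S' eqS; apply/setP => x.
by rewrite -(adj_attach_max G S) eqS adj_attach_max.
Qed.

Section Degrees.
Variables (n : nat) (G : sgraph n) (S : {set 'I_n}).

Lemma degree_attach_lift x :
  degree (attach G S) (lift ord_max x) = degree G x + (x \in S).
Proof.
rewrite !degreeE big_ord_lift adj_attach_max; congr addn.
by apply: eq_bigr => y _; rewrite adj_attach_lift.
Qed.

Lemma degree_attach_max : degree (attach G S) ord_max = #|S|.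
Proof.
rewrite degreeE big_ord_lift adj_irr addn0 -sum1_card [RHS]big_mkcond /=.
by apply: eq_bigr => y _; rewrite adj_sym adj_attach_max; case: (_ \in _).
Qed.

End Degrees.

(** * Conservation of the total deficit *)

Definition valid (m n : nat) (G : sgraph n) : bool :=
  [forall x, m <= degree G x <= 2 * m]
    && (\sum_x (2 * m - degree G x) == m * m.+1).

Definition open_set (m n : nat) (G : sgraph n) : {set 'I_n} :=
  [set x | degree G x < 2 * m].

Lemma choicesE m n (G : sgraph n) S :
  (S \in choices m (2 * m) G) = (S \subset open_set m G) && (#|S| == m).
Proof. by rewrite inE. Qed.

Lemma valid_complete m : valid m (complete_graph m.+1).
Proof.
have deg x : degree (complete_graph m.+1) x = m.
  rewrite /degree (_ : [set y | _] = [set~ x]) ?cardsC1 ?card_ord //.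
  by apply/setP => y; rewrite !inE /adj ffunE /= eq_sym.
apply/andP; split; first by apply/forallP => x; rewrite deg; lia.
under eq_bigr do rewrite deg.
by rewrite sum_nat_const card_ord; apply/eqP; lia.
Qed.

Section Valid.
Variables (m n : nat) (G : sgraph n).
Hypothesis validG : valid m G.

Lemma valid_degree x : m <= degree G x <= 2 * m.
Proof. by case/andP: validG => /forallP. Qed.

Lemma valid_deficit : \sum_x (2 * m - degree G x) = m * m.+1.
Proof. by case/andP: validG => _ /eqP. Qed.

(** The new vertex has degree [m] and brings the deficit [m]; each of its [m] neighbours, being
    open, loses exactly 1. *)
Lemma valid_attach S : S \in choices m (2 * m) G -> valid m (attach G S).
Proof.
rewrite choicesE => /andP[/subsetP subS /eqP cardS]; apply/andP; split.
  apply/forallP => x; case: (unliftP ord_max x) => [y|] ->; last first.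
    by rewrite degree_attach_max cardS; lia.
  rewrite degree_attach_lift; have := valid_degree y.
  by case: (boolP (y \in S)) => [/subS|_]; rewrite ?inE; lia.
rewrite big_ord_lift degree_attach_max cardS.
suff: \sum_x (2 * m - degree (attach G S) (lift ord_max x)) + m = m * m.+1.
  by move=> <-; rewrite (_ : 2 * m - m = m)//; lia.
rewrite -valid_deficit -{2}cardS -sum1_card [X in _ + X]big_mkcond -big_split /=.
apply: eq_bigr => x _; rewrite degree_attach_lift.
by case: (boolP (x \in S)) => [/subS|_]; rewrite ?inE; lia.
Qed.

Lemma deficit_open :
  \sum_(x in open_set m G) (2 * m - degree G x) = m * m.+1.
Proof.
rewrite -valid_deficit [LHS]big_mkcond; apply: eq_bigr => x _.
by rewrite inE; case: ifP => // /negbT; lia.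
Qed.

Lemma card_open_le : #|open_set m G| <= m * m.+1.
Proof.
rewrite -deficit_open -sum1_card; apply: leq_sum => x.
by rewrite inE subn_gt0.
Qed.

(** All degrees are at least [m], so an open vertex accounts for at most [m] of the total deficit
    [m * m.+1]. *)
Lemma card_open_gt : 0 < m -> m < #|open_set m G|.
Proof.
move=> m_gt0; rewrite -(leq_pmul2r m_gt0) mulnC -deficit_open -sum_nat_const.
by apply: leq_sum => x _; have := valid_degree x; lia.
Qed.

Lemma card_choices_gt0 : 0 < m -> 0 < #|choices m (2 * m) G|.
Proof. by move=> m_gt0; rewrite cards_draws bin_gt0 ltnW ?card_open_gt. Qed.

End Valid.

(* The state of the process: the open vertices, listed in all possible ways by
   [m * m.+1] constants, with their degrees and their rank-[k] types. *)
Definition state_type (m k : nat) : finType :=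
  {set fo_type k (m * m.+1) * {ffun 'I_(m * m.+1) -> 'I_(2 * m).+1}}.

Definition degrees (m n : nat) (G : sgraph n) (b : nat) (e : 'I_b -> 'I_n) :
    {ffun 'I_b -> 'I_(2 * m).+1} :=
  [ffun i => inord (degree G (e i))].

(** Repetitions are allowed, so that lists of the fixed length [m * m.+1] serve for any positive
    number of open vertices up to this bound. *)
Definition lists (n b : nat) (A : {set 'I_n}) (e : 'I_b -> 'I_n) : bool :=
  e @: [set: 'I_b] == A.

Definition state (m k n : nat) (G : sgraph n) : state_type m k :=
  [set (tp (adj G) k e, degrees m G e) |
    e : {ffun 'I_(m * m.+1) -> 'I_n} & lists (open_set m G) e].

Definition choices_to (m k n : nat) (G : sgraph n) (y : state_type m k) :
    {set {set 'I_n}} :=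
  [set S in choices m (2 * m) G | state m k (attach G S) == y].

Lemma lists_in n b (A : {set 'I_n}) (e : 'I_b -> 'I_n) i :
  lists A e -> e i \in A.
Proof. by move=> /eqP <-; rewrite imset_f. Qed.

Lemma listsP n b (A : {set 'I_n}) (e : 'I_b -> 'I_n) :
  reflect (forall x, x \in A <-> exists i, e i = x) (lists A e).
Proof.
apply: (iffP eqP) => [<- x|h].
  by split=> [/imsetP[i _ ->]|[i <-]]; [exists i | apply: imset_f].
apply/setP => x; apply/imsetP/idP => [[i _ ->]|/h[i <-]]; last by exists i.
by apply/h; exists i.
Qed.

Lemma ffun_env (b : nat) (V : Type) (e : 'I_b -> V) :
  finfun e = e :> ('I_b -> V).
Proof. by apply: boolp.funext => i; rewrite ffunE. Qed.

Lemma stateP m k n (G : sgraph n) (t : _ * _) :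
  reflect (exists e, [/\ lists (open_set m G) e, t.1 = tp (adj G) k e
     & t.2 = degrees m G e]) (t \in state m k G).
Proof.
apply: (iffP imsetP) => [[e]|[e [le t1 t2]]].
  by rewrite inE => le ->; exists e.
exists (finfun e); rewrite ?inE ffun_env //.
by case: t t1 t2 => ? ? /= -> ->; congr pair.
Qed.

Lemma lists_exists n b (A : {set 'I_n}) :
  0 < #|A| <= b -> exists e : 'I_b -> 'I_n, lists A e.
Proof.
move=> /andP[/card_gt0P[x0 Ax0] leA].
exists (fun i : 'I_b => nth x0 (enum A) i); apply/listsP => x; split.
  rewrite -mem_enum => Ax; have := Ax; rewrite -index_mem -cardE => ltx.
  by exists (Ordinal (leq_trans ltx leA)); rewrite /= nth_index.
move=> [i <-]; case: (ltnP i (size (enum A))) => [lti|gei].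
  by rewrite -mem_enum mem_nth.
by rewrite nth_default.
Qed.

Lemma state_eq m k n n' (G : sgraph n) (H : sgraph n') :
  0 < m -> valid m G -> state m k G = state m k H ->
  exists (e : 'I_(m * m.+1) -> 'I_n) (e' : 'I_(m * m.+1) -> 'I_n'),
  [/\ lists (open_set m G) e, lists (open_set m H) e',
    tp (adj G) k e = tp (adj H) k e' & degrees m G e = degrees m H e'].
Proof.
move=> m_gt0 vG eqGH.
have [|e le] := @lists_exists n (m * m.+1) (open_set m G).
  by rewrite card_open_le // (leq_trans _ (card_open_gt vG m_gt0)).
have: (tp (adj G) k e, degrees m G e) \in state m k G.
  by apply/stateP; exists e.
by rewrite eqGH => /stateP[e' [le' /= t1 t2]]; exists e, e'.
Qed.

(** Validity bounds the degrees by [2 * m], so the [inord] in [degrees] loses nothing. *)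
Lemma degrees_degree m n n' (G : sgraph n) (H : sgraph n') b
    (e : 'I_b -> 'I_n) (e' : 'I_b -> 'I_n') i :
  valid m G -> valid m H -> degrees m G e = degrees m H e' ->
  degree G (e i) = degree H (e' i).
Proof.
move=> vG vH /ffunP/(_ i); rewrite !ffunE => /(congr1 (@nat_of_ord _)).
have /andP[_ ?] := valid_degree vG (e i).
have /andP[_ ?] := valid_degree vH (e' i).
by rewrite !inordK.
Qed.

(** * Types after the attachment of a vertex *)

Definition attach_env (n b : nat) (e : 'I_b -> 'I_n) (o : option 'I_b) :
    'I_n.+1 :=
  if o is Some i then lift ord_max (e i) else ord_max.

Section AttachEnv.
Variables (n n' : nat) (G : sgraph n) (H : sgraph n').
Variables (S : {set 'I_n}) (S' : {set 'I_n'}).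

Definition matched b (e : 'I_b -> 'I_n) (e' : 'I_b -> 'I_n') : Prop :=
  [/\ forall i, (e i \in S) = (e' i \in S'),
      forall x, x \in S -> exists i, e i = x
    & forall x, x \in S' -> exists i, e' i = x].

(** All elements of [S] and [S'] are already marked, so the equalities between the new mark and the
    old ones decide whether it belongs to the set. *)
Lemma matched_cons b (e : 'I_b -> 'I_n) (e' : 'I_b -> 'I_n') x y :
  matched e e' ->
  atp (adj G) (env_cons x e) = atp (adj H) (env_cons y e') ->
  matched (env_cons x e) (env_cons y e').
Proof.
move=> [eS im im'] eqt; split.
- move=> i; case: (unliftP ord0 i) => [j|] ->; first by rewrite !env_consS.
  rewrite !env_cons0; apply/idP/idP.
    move=> Sx; have [j ejx] := im _ Sx.
    have := atp_eq ord0 (lift ord0 j) eqt; rewrite !env_cons0 !env_consS ejx eqxx.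
    by move=> /esym/eqP ->; rewrite -eS ejx.
  move=> Sx; have [j ejx] := im' _ Sx.
  have := atp_eq ord0 (lift ord0 j) eqt; rewrite !env_cons0 !env_consS ejx eqxx.
  by move=> /eqP ->; rewrite eS ejx.
- by move=> z /im[i <-]; exists (lift ord0 i); rewrite env_consS.
- by move=> z /im'[i <-]; exists (lift ord0 i); rewrite env_consS.
Qed.

Lemma attach_atomic b (e : 'I_b -> 'I_n) (e' : 'I_b -> 'I_n') c
    (r : 'I_c -> option 'I_b) :
  atp (adj G) e = atp (adj H) e' -> matched e e' ->
  atp (adj (attach G S)) (attach_env e \o r)
    = atp (adj (attach H S')) (attach_env e' \o r).
Proof.
move=> eqt [eS _ _]; apply/ffunP => -[i j]; rewrite !ffunE /=.
case: (r i) => [i'|]; case: (r j) => [j'|] /=; rewrite ?eqxx ?adj_irr //.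
- rewrite !adj_attach_lift !(inj_eq lift_inj).
  by rewrite (atp_adj _ _ eqt) (atp_eq _ _ eqt).
- by rewrite !adj_attach_max eS !(eq_sym _ ord_max) !(negbTE (neq_lift _ _)).
- by rewrite !(adj_sym _ ord_max) !adj_attach_max eS !(negbTE (neq_lift _ _)).
Qed.

Lemma attach_env_new b (e : 'I_b -> 'I_n) c (r : 'I_c -> option 'I_b) :
  attach_env e \o env_cons None r = env_cons ord_max (attach_env e \o r).
Proof. by apply: env_consP => [|i] /=; rewrite ?env_cons0 ?env_consS. Qed.

Lemma attach_env_old b (e : 'I_b -> 'I_n) c (r : 'I_c -> option 'I_b) x :
  attach_env (env_cons x e)
      \o env_cons (Some ord0) (fun i => omap (lift ord0) (r i))
    = env_cons (lift ord_max x) (attach_env e \o r).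
Proof.
apply: env_consP => [|i] /=; rewrite ?env_cons0 /= ?env_cons0 // env_consS.
by case: (r i) => [j|] //=; rewrite env_consS.
Qed.

End AttachEnv.

(** A pebble is either the new vertex ([None]) or a marked old vertex ([Some i]), as recorded by
    [r]. The new vertex is answered by the new vertex, an old one by the strategy for [G] and
    [H]. *)
Lemma tp_attach n n' (G : sgraph n) (H : sgraph n') S S' k b
    (e : 'I_b -> 'I_n) (e' : 'I_b -> 'I_n') c (r : 'I_c -> option 'I_b) :
  tp (adj G) k e = tp (adj H) k e' -> matched S S' e e' ->
  tp (adj (attach G S)) k (attach_env e \o r)
    = tp (adj (attach H S')) k (attach_env e' \o r).
Proof.
move=> eqt mee'.
apply: (tp_bf (Z := fun k c f f' => exists b (e : 'I_b -> 'I_n) e' r,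
  [/\ tp (adj G) k e = tp (adj H) k e', matched S S' e e',
     f = attach_env e \o r & f' = attach_env e' \o r])); last first.
- by exists b, e, e', r.
- move=> {b c e e' r eqt mee'} {}k c f f' [b [e [e' [r [eqt mee' -> ->]]]]] y.
  case: (unliftP ord_max y) => [z|] ->.
    have [x eqt'] := tp_back z eqt; exists (lift ord_max x).
    exists b.+1, (env_cons x e), (env_cons z e').
    exists (env_cons (Some ord0) (fun i => omap (lift ord0) (r i))).
    rewrite !attach_env_old; split=> //.
    exact: matched_cons mee' (tp_atp eqt').
  (* No move is made in the game on the old graphs: it merely loses a round, by [tp_pred]. *)
  exists ord_max, b, e, e', (env_cons None r).
  by rewrite !attach_env_new; split=> //; apply: tp_pred.
- move=> {b c e e' r eqt mee'} {}k c f f' [b [e [e' [r [eqt mee' -> ->]]]]] y.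
  case: (unliftP ord_max y) => [z|] ->.
    have [x eqt'] := tp_forth z eqt; exists (lift ord_max x).
    exists b.+1, (env_cons z e), (env_cons x e').
    exists (env_cons (Some ord0) (fun i => omap (lift ord0) (r i))).
    rewrite !attach_env_old; split=> //.
    exact: matched_cons mee' (tp_atp eqt').
  exists ord_max, b, e, e', (env_cons None r).
  by rewrite !attach_env_new; split=> //; apply: tp_pred.
- move=> {b c e e' r eqt mee'} {}k c f f' [b [e [e' [r [/tp_atp eqt mee' -> ->]]]]].
  exact: attach_atomic.
Qed.

Section StateStep.
Variables (m k n n' b : nat) (G : sgraph n) (H : sgraph n').
Variables (e : 'I_b -> 'I_n) (e' : 'I_b -> 'I_n').
Hypotheses (m_gt0 : 0 < m) (vG : valid m G) (vH : valid m H).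
Hypotheses (le : lists (open_set m G) e) (le' : lists (open_set m H) e').
Hypotheses (eqt : tp (adj G) k e = tp (adj H) k e').
Hypotheses (eqd : degrees m G e = degrees m H e').

(** Degrees never decrease, so an open vertex of the larger graph is the new one or was open before.
    Any list [f] of them therefore factors through [e] and the new vertex, and the same pattern [r]
    applied to [e'] gives the required list in the other graph. *)
Lemma state_attach_sub S S' :
  S \in choices m (2 * m) G -> S' \in choices m (2 * m) H ->
  (forall i, (e i \in S) = (e' i \in S')) ->
  state m k (attach G S) \subset state m k (attach H S').
Proof.
move=> chS chS' eS; have := chS; have := chS'; rewrite !choicesE.
move=> /andP[/subsetP subS' /eqP cS'] /andP[/subsetP subS /eqP cS].
have /listsP imG := le; have /listsP imH := le'.
have mee' : matched S S' e e'.
  by split=> // x; [move=> /subS/imG | move=> /subS'/imH].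
have degE i : degree (attach G S) (lift ord_max (e i))
    = degree (attach H S') (lift ord_max (e' i)).
  by rewrite !degree_attach_lift eS (degrees_degree _ vG vH eqd).
have degM : degree (attach G S) ord_max = degree (attach H S') ord_max.
  by rewrite !degree_attach_max cS cS'.
apply/subsetP => -[t ds] /stateP[f [/listsP lf /= -> ->]]; apply/stateP.
have fP i : exists o, f i = attach_env e o.
  have: f i \in open_set m (attach G S) by apply/lf; exists i.
  case: (unliftP ord_max (f i)) => [x|] -> h; last by exists None.
  suff /imG[j <-] : x \in open_set m G by exists (Some j).
  by move: h; rewrite !inE degree_attach_lift; lia.
have /fin_all_exists[r fr] := fP.
exists (attach_env e' \o r); split=> /=; last first.
- by apply/ffunP => i; rewrite !ffunE fr /=; case: (r i) => [j|] /=;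
    rewrite ?degE ?degM.
- rewrite (_ : f = attach_env e \o r); last by apply: boolp.funext.
  exact: tp_attach.
apply/listsP => y; split; last first.
  move=> [i <-]; have: f i \in open_set m (attach G S) by apply/lf; exists i.
  by rewrite !inE fr /=; case: (r i) => [j|] /=; rewrite ?degE ?degM.
(* For surjectivity, an open [y] is carried back to the first graph, where [f] lists it; the
   equality pattern of the old lists turns this position into one of [y]. *)
move=> yH; suff [o fo oy] : exists2 o, attach_env e o \in open_set m (attach G S)
    & attach_env e' o = y.
  have /lf[i fi] := fo; exists i; rewrite -oy /=.
  move: fi; rewrite fr; case: (r i) (o) => [j|] [l|] //=.
  - move=> /lift_inj/eqP; rewrite (atp_eq _ _ (tp_atp eqt)) => /eqP ->; done.
  - by move=> /eqP; rewrite eq_sym (negbTE (neq_lift _ _)).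
  - by move=> /eqP; rewrite (negbTE (neq_lift _ _)).
move: yH; case: (unliftP ord_max y) => [z|] -> h; last first.
  by exists None => //=; move: h; rewrite !inE degM.
have /imH[j jz] : z \in open_set m H.
  by move: h; rewrite !inE degree_attach_lift; lia.
by exists (Some j) => /=; rewrite ?jz //; move: h; rewrite -jz !inE degE.
Qed.

End StateStep.

(** * Lumpability: the state determines the law of the next state *)

Section StateLumps.
Variables (m k n n' : nat) (G : sgraph n) (H : sgraph n').
Hypotheses (m_gt0 : 0 < m) (vG : valid m G) (vH : valid m H).

Lemma state_models phi :
  qrank phi <= k -> state m k G = state m k H -> models G phi <-> models H phi.
Proof.
by move=> lek /(state_eq m_gt0 vG)[e [e' [_ _ eqt _]]]; apply: tp_models eqt.
Qed.

Lemma choices_state_le (y : state_type m k) : state m k G = state m k H ->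
  #|choices_to G y|
    <= #|choices_to H y|.
Proof.
move=> /(state_eq m_gt0 vG)[e [e' [le le' eqt eqd]]].
have /listsP imG := le; have /listsP imH := le'.
have eqe := atp_eq _ _ (tp_atp eqt).
have [i0 _] : exists i : 'I_(m * m.+1), true.
  have /card_gt0P[x /imG[i _]] : 0 < #|open_set m G|.
    by rewrite (leq_trans _ (card_open_gt vG m_gt0)).
  by exists i.
(* The bijection between open vertices induced by the two lists; the default [i0] only serves
   vertices that [e] does not list. Taking images under [th] then injects the choices for [G] into
   those for [H] without changing the next state. *)
pose th x := e' (odflt i0 [pick i | e i == x]).
have thE i : th (e i) = e' i.
  rewrite /th; case: pickP => [j|/(_ i)] /=; last by rewrite eqxx.
  by rewrite eqe => /eqP.
have th_inj : {in open_set m G &, injective th}.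
  by move=> ? ? /imG[i <-] /imG[j <-]; rewrite !thE => /eqP; rewrite -eqe => /eqP.
have th_mem (S : {set 'I_n}) i : S \subset open_set m G ->
    (e i \in S) = (e' i \in th @: S).
  move=> /subsetP subS; apply/idP/imsetP => [Si|[x Sx]]; first by exists (e i).
  have /imG[j jx] := subS _ Sx.
  by rewrite -jx thE => /eqP; rewrite -eqe jx => /eqP ->.
rewrite -(card_in_imset (f := fun S : {set 'I_n} => th @: S)).
  apply/subset_leq_card/subsetP => _ /imsetP[S + ->].
  rewrite inE => /andP[chS /eqP eqy]; rewrite inE.
  have := chS; rewrite choicesE => /andP[subS /eqP cS].
  have chS' : th @: S \in choices m (2 * m) H.
    rewrite choicesE; apply/andP; split; last first.
      rewrite card_in_imset ?cS // => x x' /(subsetP subS)/th_inj h.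
      by move=> /(subsetP subS)/h.
    apply/subsetP => _ /imsetP[x /(subsetP subS)/imG[i <-] ->].
    by rewrite thE; apply/imH; exists i.
  rewrite chS' /= -eqy eqEsubset; apply/andP; split.
    apply: (state_attach_sub m_gt0 vH vG le' le (esym eqt) (esym eqd)) => // i.
    by rewrite -th_mem.
  by apply: (state_attach_sub m_gt0 vG vH le le' eqt eqd) => // i; rewrite -th_mem.
move=> S1 S2; rewrite !inE => /andP[/andP[s1 _] _] /andP[/andP[s2 _] _] eqS.
apply/setP => x; apply/idP/idP => Sx.
  have /imG[i ix] := subsetP s1 _ Sx; move: Sx.
  by rewrite -ix !th_mem // eqS.
have /imG[i ix] := subsetP s2 _ Sx; move: Sx.
by rewrite -ix !th_mem // eqS.
Qed.

End StateLumps.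

Lemma choices_state_eq m k n n' (G : sgraph n) (H : sgraph n')
    (y : state_type m k) :
  0 < m -> valid m G -> valid m H -> state m k G = state m k H ->
  #|choices_to G y|
    = #|choices_to H y|.
Proof.
move=> m_gt0 vG vH eqs; apply/eqP; rewrite eqn_leq.
by rewrite (choices_state_le m_gt0 vG vH) // (choices_state_le m_gt0 vH vG).
Qed.

Lemma card_choices_sum m k n (G : sgraph n) :
  \sum_(y : state_type m k) #|choices_to G y| = #|choices m (2 * m) G|.
Proof.
rewrite -sum1_card (partition_big (fun S => state m k (attach G S)) predT) //=.
by apply: eq_bigr => y _; rewrite -sum1_card; apply: eq_bigl => S; rewrite inE.
Qed.

Lemma card_choices_state_eq m k n n' (G : sgraph n) (H : sgraph n') :
  0 < m -> valid m G -> valid m H -> state m k G = state m k H ->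
  #|choices m (2 * m) G| = #|choices m (2 * m) H|.
Proof.
move=> m_gt0 vG vH eqs; rewrite -!(card_choices_sum _ k).
by apply: eq_bigr => y _; apply: choices_state_eq.
Qed.

(** * A continuation of period one *)

(* Any m consecutive numbers have distinct slots, and among the numbers below
   m(m+1) exactly [m - j./2] have slot j: this is what remains for the vertex
   [n0 + j] once it is joined to [n0 + j - 2], [n0 + j - 4], ... *)
Definition slot (m t : nat) : nat :=
  if t %/ m + t %% m < m then (t %% m).*2 else (m.-1 - t %% m).*2.+1.

Lemma slot_lt m t : 0 < m -> slot m t < 2 * m.
Proof. by move=> m_gt0; rewrite /slot; have := ltn_pmod t m_gt0; case: ifP; lia. Qed.

(** The parity of a slot tells which branch defines it, and then its value gives [t %% m]. Since a
    deficit is at most [m], this prevents a double edge between an old vertex and a new one. *)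
Lemma slot_neq m t t' : 0 < m -> t < t' < t + m -> slot m t != slot m t'.
Proof.
move=> m_gt0 /andP[lt1 lt2]; apply/eqP => eqs.
have eqm : t %% m = t' %% m.
  move: eqs; rewrite /slot; have := ltn_pmod t m_gt0; have := ltn_pmod t' m_gt0.
  by case: ifP; case: ifP; lia.
have : t' - t < m by lia.
have /eqP : t' = t %[mod m] by [].
by rewrite eqn_mod_dvd ?(ltnW lt1) // => /dvdn_leq; rewrite subn_gt0 lt1; lia.
Qed.

Lemma sum_nat_interval (F : nat) (a b : nat) : a <= b <= F ->
  \sum_(t < F) (a <= t < b : nat) = b - a.
Proof.
move=> /andP[ab bF].
suff -> : \sum_(t < F) (a <= t < b : nat) = minn b F - minn a F by lia.
by elim: F {bF} => [|F IH]; rewrite ?big_ord0 ?big_ord_recr /= ?IH; lia.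
Qed.

(** Write [t] as [q * m + p]. An even [j] forces [p = j./2] and leaves the [m - p] quotients
    [q < m - p]; an odd [j] forces [p = m - j./2.+1] and leaves those from [j./2.+1] to [m]. *)
Lemma slot_count m j : 0 < m ->
  \sum_(t < m * m.+1) (slot m t == j : nat) = m - j./2.
Proof.
move=> m_gt0.
have sumE (F : nat -> nat) r :
    \sum_(t < m * r) F t = \sum_(p < m) \sum_(q < r) F (q * m + p).
  elim: r => [|r IH].
    by rewrite muln0 big_ord0 big1 // => i _; rewrite big_ord0.
  rewrite mulnSr big_split_ord /= IH.
  under [RHS]eq_bigr do rewrite big_ord_recr /=.
  by rewrite big_split /=; congr addn; apply: eq_bigr => i _; rewrite mulnC.
rewrite (sumE (fun t => (slot m t == j : nat))).
have slotE (p : 'I_m) (q : 'I_m.+1) : (slot m (q * m + p) == j)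
    = if odd j then (p + j./2.+1 == m) && (j./2.+1 <= q < m.+1)
      else (p == j./2 :> nat) && (0 <= q < m - p).
  rewrite /slot divnMDl // divn_small // addn0 modnMDl modn_small //.
  have := ltn_ord p; have := ltn_ord q; have := odd_double_half j.
  by case: (odd j); case: ifP => ? ? ? ?; apply/idP/idP; lia.
under eq_bigr do under eq_bigr do rewrite slotE.
case: (ltnP j./2 m) => [ltj|gej]; last first.
  rewrite (_ : m - j./2 = 0); last by lia.
  apply: big1 => p _; apply: big1 => q _; have := ltn_ord p.
  by case: (odd j); case: eqP => //=; lia.
case: (odd j).
  have lt : m - j./2.+1 < m by lia.
  rewrite (bigD1 (Ordinal lt)) //= [X in _ + X]big1 ?addn0 => [|p /eqP neq].
    rewrite subnK // eqxx /=
      (eq_bigr (fun q : 'I_m.+1 => (j./2.+1 <= q < m.+1 : nat))) //.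
    by rewrite sum_nat_interval; lia.
  apply: big1 => q _; case: eqP => //= eqm; case: neq; apply: val_inj => /=; lia.
rewrite (bigD1 (Ordinal ltj)) //= [X in _ + X]big1 ?addn0 => [|p /eqP neq].
  by rewrite eqxx /= (@sum_nat_interval _ 0); lia.
by apply: big1 => q _; case: eqP => //= eqm; case: neq; apply: val_inj.
Qed.

Section Steady.
Variables (m n0 : nat) (G : sgraph n0).

Definition deficit (u : nat) : nat :=
  if insub u is Some x then 2 * m - degree G (x : 'I_n0) else 0.

Definition offset (u : nat) : nat := \sum_(i < u) deficit i.

(* [attaches j u]: the vertex [n0 + j] is joined to the older vertex [u].  The
   missing half-edges of the vertices [u < n0] are numbered consecutively from
   0 to [m * m.+1 - 1], those of [u] starting at [offset u]. *)
Definition attaches (j u : nat) : bool :=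
  if u < n0 then
    [exists t : 'I_(m * m.+1), (slot m t == j) && (offset u <= t < offset u.+1)]
  else (0 < n0 + j - u <= 2 * m) && ~~ odd (n0 + j - u).

(** The size is [j + n0], not [n0 + j], so that it reduces to the successor required by [attach]. *)
Fixpoint steady (j : nat) : sgraph (j + n0) :=
  if j is j'.+1 then
    attach (steady j') [set u : 'I_(j' + n0) | attaches j' u]
  else G.

Definition total_hits (j u : nat) : nat := \sum_(i < j) attaches i u.

Definition base_degree (u : nat) : nat := if u < n0 then 2 * m - deficit u else m.

Hypotheses (m_gt0 : 0 < m) (vG : valid m G).

Lemma deficitE (x : 'I_n0) : deficit x = 2 * m - degree G x.
Proof. by rewrite /deficit valK. Qed.

Lemma deficit_le u : deficit u <= m.
Proof.
by rewrite /deficit; case: insubP => // x _ _; have := valid_degree vG x; lia.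
Qed.

Lemma offsetS u : offset u.+1 = offset u + deficit u.
Proof. by rewrite /offset big_ord_recr. Qed.

Lemma offset_max : offset n0 = m * m.+1.
Proof. by rewrite -(valid_deficit vG); apply: eq_bigr => x _; rewrite deficitE. Qed.

Lemma offset_le u : u < n0 -> offset u.+1 <= m * m.+1.
Proof.
rewrite -offset_max /offset => lt.
rewrite -!(big_mkord predT) [leqRHS](big_cat_nat (n := u.+1)) //=.
exact: leq_addr.
Qed.

(** At most one term is nonzero: the half-edges of [u] are at most [m] consecutive numbers, whose
    slots differ. *)
Lemma attaches_oldE j u : u < n0 -> attaches j u =
  \sum_(t < m * m.+1) (slot m t == j) * (offset u <= t < offset u.+1) :> nat.
Proof.
move=> ltu; rewrite /attaches ltu.
case: existsP => [[t /andP[st It]]|nex]; last first.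
  rewrite big1 // => t _; apply/eqP; rewrite muln_eq0 !eqb0 -negb_and.
  by apply/negP => h; apply: nex; exists t.
rewrite (bigD1 t) //= st It big1 // => t' neq.
apply/eqP; rewrite muln_eq0 !eqb0 -negb_and; apply/negP => /andP[st' It'].
move: It It'; rewrite offsetS; have := deficit_le u => led It It'.
have neq' : nat_of_ord t' != t by [].
case: (ltngtP t t') neq' => // lt _.
  by have /eqP[] := @slot_neq m t t' m_gt0 ltac:(lia); rewrite (eqP st) (eqP st').
by have /eqP[] := @slot_neq m t' t m_gt0 ltac:(lia); rewrite (eqP st) (eqP st').
Qed.

Lemma total_hits_old j u : u < n0 ->
  total_hits j u =
    \sum_(t < m * m.+1) (slot m t < j) * (offset u <= t < offset u.+1).
Proof.
move=> ltu; rewrite /total_hits; under eq_bigr do rewrite attaches_oldE //.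
rewrite exchange_big /=; apply: eq_bigr => t _; rewrite -big_distrl /=; congr muln.
elim: j => [|j IH]; first by rewrite big_ord0.
by rewrite big_ord_recr /= IH; lia.
Qed.

Lemma total_hits_old_le j u : u < n0 -> total_hits j u <= deficit u.
Proof.
move=> ltu; rewrite total_hits_old //.
have -> : deficit u = offset u.+1 - offset u by rewrite offsetS addKn.
rewrite -(@sum_nat_interval (m * m.+1)); last first.
  by rewrite offset_le // offsetS leq_addr.
by apply: leq_sum => t _; rewrite -[leqRHS]mul1n leq_mul2r leq_b1 orbT.
Qed.

(** All slots are below [2 * m], so by then every missing half-edge of an old vertex has been
    used. *)
Lemma total_hits_old_max j u : u < n0 -> 2 * m <= j -> total_hits j u = deficit u.
Proof.
move=> ltu lej; rewrite total_hits_old //.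
have -> : deficit u = offset u.+1 - offset u by rewrite offsetS addKn.
rewrite -(@sum_nat_interval (m * m.+1)); last first.
  by rewrite offset_le // offsetS leq_addr.
by apply: eq_bigr => t _; rewrite (leq_trans (slot_lt _ m_gt0)) ?mul1n.
Qed.

Lemma attaches_new j i :
  attaches j (n0 + i) = (0 < j - i <= 2 * m) && ~~ odd (j - i).
Proof. by rewrite /attaches ltnNge leq_addr /= subnDl. Qed.

Lemma total_hits_new j i : total_hits j (n0 + i) = minn m (j - i.+1)./2.
Proof.
rewrite /total_hits; elim: j => [|j IH]; first by rewrite big_ord0; lia.
by rewrite big_ord_recr /= IH attaches_new; lia.
Qed.

(** The vertex [n0 + j] has [minn m j./2] neighbours among the added vertices and, by [slot_count],
    [m - j./2] among the old ones. *)
Lemma card_attaches j : #|[set u : 'I_(j + n0) | attaches j u]| = m.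
Proof.
rewrite -sum1dep_card big_mkcond /=.
rewrite (eq_bigr (fun u : 'I__ => attaches j u : nat)); last first.
  by move=> u _; case: attaches.
rewrite -(big_mkord predT (fun u => attaches j u : nat)).
rewrite (big_cat_nat (n := n0)) ?leq_addl //=.
rewrite -{2}[n0]add0n big_addn addnK !big_mkord.
have -> : \sum_(i < j) attaches j (i + n0) = minn m j./2.
  rewrite (eq_bigr (fun i : 'I_j => (0 < j - i <= 2 * m) && ~~ odd (j - i) : nat)).
    rewrite (reindex_inj rev_ord_inj) /=.
    rewrite (eq_bigr (fun i : 'I_j => (i.+1 <= 2 * m) && ~~ odd i.+1 : nat)).
      elim: j => [|j IH]; first by rewrite big_ord0; lia.
      by rewrite big_ord_recr /= IH; lia.
    by move=> i _; have := ltn_ord i => ?; rewrite subKn.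
  by move=> i _; rewrite addnC attaches_new.
under eq_bigr do rewrite attaches_oldE //.
rewrite exchange_big /=.
rewrite (eq_bigr (fun t : 'I_(m * m.+1) => (slot m t == j : nat))).
  by rewrite slot_count //; lia.
move=> t _; rewrite -big_distrr /=.
(* The intervals of the old vertices partition the numbers below [offset n0], so each half-edge is
   counted once. *)
have -> : \sum_(i < n0) (offset i <= t < offset i.+1) = (t < offset n0).
  elim: (n0) => [|u IH]; first by rewrite /offset !big_ord0.
  by rewrite big_ord_recr /= IH offsetS; lia.
by rewrite offset_max ltn_ord muln1.
Qed.

Lemma attaches_lt j u : attaches j u -> u < j + n0.
Proof. by rewrite /attaches; case: ifP => [|_ /andP[]]; lia. Qed.

Lemma degree_steady j (u : 'I_(j + n0)) :
  degree (steady j) u = base_degree u + total_hits j u.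
Proof.
elim: j u => [|j IH] u.
  rewrite /total_hits big_ord0 addn0 /base_degree ltn_ord deficitE /=.
  by have := valid_degree vG u; rewrite -[degree _ u]/(@degree n0 G u); lia.
rewrite /total_hits big_ord_recr /= -/(total_hits j u) addnA.
case: (unliftP ord_max u) => [v|] ->.
  have -> : nat_of_ord (lift ord_max v) = v by rewrite -widen_lift.
  by rewrite degree_attach_lift IH inE.
rewrite degree_attach_max card_attaches.
have -> : nat_of_ord (ord_max : 'I_(j + n0).+1) = n0 + j by rewrite /= addnC.
by rewrite /base_degree ltnNge leq_addr /= total_hits_new attaches_new; lia.
Qed.

(** An old vertex never receives more than its deficit, this edge included; an added one at distance
    at most [2 * m] has received fewer than [m] edges so far. *)
Lemma steady_choice j :
  [set u : 'I_(j + n0) | attaches j u] \in choices m (2 * m) (steady j).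
Proof.
rewrite choicesE card_attaches eqxx andbT; apply/subsetP => u.
rewrite !inE degree_steady /base_degree => attu.
case: (ltnP u n0) => [ltu|geu].
  have := total_hits_old_le j.+1 ltu; have := deficit_le u.
  by rewrite /total_hits big_ord_recr /= attu; lia.
have uE : nat_of_ord u = n0 + (u - n0) by rewrite subnKC.
by move: attu; rewrite uE total_hits_new attaches_new; lia.
Qed.

Lemma valid_steady j : valid m (steady j).
Proof. by elim: j => //= j IH; apply: valid_attach => //; apply: steady_choice. Qed.

Lemma open_steady j (u : 'I_(j + n0)) : 2 * m <= j ->
  (u \in open_set m (steady j)) = (n0 + j <= u + 2 * m).
Proof.
move=> lej; rewrite inE degree_steady /base_degree.
case: (ltnP u n0) => [ltu|geu].
  by rewrite total_hits_old_max //; have := deficit_le u; lia.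
have uE : nat_of_ord u = n0 + (u - n0) by rewrite subnKC.
by rewrite uE total_hits_new; lia.
Qed.

(** * Periodicity of the continuation *)

Definition steady_rel (u v : nat) : bool :=
  if (insub u, insub v) is (Some x, Some y) then adj G (x : 'I_n0) (y : 'I_n0)
  else if u < v then attaches (v - n0) u else attaches (u - n0) v.

Lemma adj_steady j (u v : 'I_(j + n0)) : adj (steady j) u v = steady_rel u v.
Proof.
elim: j u v => [|j IH] u v; first by rewrite /steady_rel !valK.
have liftE (x : 'I_(j + n0)) : nat_of_ord (lift (ord_max : 'I_(j + n0).+1) x) = x.
  by rewrite -widen_lift.
have none : insub (j + n0) = None :> option 'I_n0.
  by rewrite insubF // ltnNge leq_addl.
case: (unliftP ord_max u) => [x|] ->; case: (unliftP ord_max v) => [y|] ->.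
- by rewrite [LHS]adj_attach_lift IH !liftE.
- rewrite [LHS]adj_attach_max inE liftE /steady_rel /= none ltn_ord addnK.
  by case: insub.
- rewrite [LHS]adj_sym [LHS]adj_attach_max inE liftE /steady_rel /= none.
  by rewrite ltnNge ltnW //= addnK.
- rewrite [LHS]adj_irr /steady_rel /= none ltnn addnK; apply/esym/negbTE/negP.
  by move=> /attaches_lt; rewrite ltnn.
Qed.

Lemma insub_ge u : n0 <= u -> insub u = None :> option 'I_n0.
Proof. by move=> le; rewrite insubF // ltnNge le. Qed.

Lemma attaches_near j u : 2 * m <= j -> attaches j u -> n0 + j <= u + 2 * m.
Proof.
move=> lej; rewrite /attaches; case: ifP => [_|_ /andP[/andP[] ]]; last by lia.
by case/existsP => t /andP[/eqP st _]; have := slot_lt t m_gt0; lia.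
Qed.

Lemma steady_rel_shift u v : n0 <= u -> n0 <= v ->
  steady_rel u.+1 v.+1 = steady_rel u v.
Proof.
move=> leu lev; rewrite /steady_rel !insub_ge ?(leqW leu) ?(leqW lev) //=.
rewrite -(subnKC leu) -(subnKC lev); move: (u - n0) (v - n0) => i j.
rewrite -!addnS !addKn !attaches_new !subSS; case: ifP; case: ifP; lia.
Qed.

Lemma steady_rel_far u v : n0 + 2 * m <= v -> u + 2 * m < v ->
  steady_rel u v = false /\ steady_rel v u = false.
Proof.
move=> lev far; rewrite /steady_rel (insub_ge (u := v)); last by lia.
have -> : (u < v) = true by lia.
have -> : (v < u) = false by lia.
have far' : attaches (v - n0) u = false.
  by apply/negbTE/negP => /attaches_near; lia.
by rewrite far'; case: insub.
Qed.

(* Beyond the transitory part the graph has period 1: inserting one vertex at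
   a cut [c] far from all the marked vertices is invisible. *)
Lemma tp_steadyS k N c b (e : 'I_b -> 'I_(N + n0)) (e' : 'I_b -> 'I_(N.+1 + n0)) :
  n0 + 2 * m + 2 * m * 2 ^ k <= c -> c + 2 * m * 2 ^ k <= N + n0 ->
  (forall i, (e i + 2 * m * 2 ^ k <= c) || (c + 2 * m * 2 ^ k <= e i)) ->
  (forall i, e' i = e i + (c <= e i) :> nat) ->
  tp (adj (steady N)) k e = tp (adj (steady N.+1)) k e'.
Proof.
move=> c_ge c_le far e'E.
apply: (tp_bf (Z := fun k b (e : 'I_b -> 'I_(N + n0))
    (e' : 'I_b -> 'I_(N.+1 + n0)) =>
  exists c, [/\ n0 + 2 * m + 2 * m * 2 ^ k <= c, c + 2 * m * 2 ^ k <= N + n0,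
    forall i, (e i + 2 * m * 2 ^ k <= c) || (c + 2 * m * 2 ^ k <= e i) &
    forall i, e' i = e i + (c <= e i) :> nat])); last by exists c.
- move=> {k c b e e' c_ge c_le far e'E} k b e e' [c [c_ge c_le far e'E]].
  have r_gt0 : 2 * m <= 2 * m * 2 ^ k by rewrite leq_pmulr ?expn_gt0.
  move: (2 * m * 2 ^ k) r_gt0 c_ge c_le far => r r_ge c_ge c_le far.
  apply/ffunP => -[i j]; rewrite !ffunE /= !adj_steady //.
  rewrite -(inj_eq val_inj (e i)) -(inj_eq val_inj (e' i)) /= !e'E.
  have := far i; have := far j; move: (e i : nat) (e j : nat) => u v fv fu.
  congr pair; last by case: (leqP c u); case: (leqP c v); lia.
  (* Two marks on the same side of the cut are both fixed or both shifted; on different sides they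
     are more than [2 * m] apart, hence not adjacent in either graph. *)
  case: (leqP c u) => cu; case: (leqP c v) => cv; rewrite ?addn1 ?addn0 //.
  + by rewrite steady_rel_shift; lia.
  + by rewrite !(proj2 (steady_rel_far _ _)); lia.
  + by rewrite !(proj1 (steady_rel_far _ _)); lia.
- move=> {k c b e e' c_ge c_le far e'E} k b e e' [c []].
  rewrite expnS (mulnCA _ 2); move: (2 * m * 2 ^ k) => r c_ge c_le far e'E x.
  (* The old marks are at distance at least [2 * r] from [c]. Moving the cut by [r] away from [x]
     leaves all marks, [x] included, at distance at least [r], and crosses none of them. *)
  pose c' := if x < c then c + r else c - r.
  have xlt : x + (c' <= x) < N.+1 + n0 by have := ltn_ord x; lia.
  exists (Ordinal xlt), c'; split; rewrite /c'.
  + by case: ifP; lia.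
  + by case: ifP; lia.
  + move=> i; case: (unliftP ord0 i) => [j|] ->; rewrite ?env_cons0 ?env_consS.
      by have := far j; case: ifP; lia.
    by case: ifP; lia.
  + move=> i; case: (unliftP ord0 i) => [j|] ->; rewrite ?env_cons0 ?env_consS //.
    by rewrite e'E; have := far j; case: ifP; lia.
- move=> {k c b e e' c_ge c_le far e'E} k b e e' [c []].
  have r_gt0 : 0 < 2 * m * 2 ^ k by rewrite !muln_gt0 m_gt0 expn_gt0.
  rewrite expnS (mulnCA _ 2).
  move: (2 * m * 2 ^ k) r_gt0 => r r_gt0 c_ge c_le far e'E y.
  (* Here [y] lives in the longer graph, where [c] is the inserted vertex: for [y = c] the answer is
     [c] itself, which lies left of the new cut because [r] is positive. *)
  pose c' := if y <= c then c + r else c - r.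
  have ylt : y - (c < y) < N + n0 by have := ltn_ord y; lia.
  exists (Ordinal ylt), c'; split; rewrite /c'.
  + by case: ifP; lia.
  + by case: ifP; lia.
  + move=> i; case: (unliftP ord0 i) => [j|] ->; rewrite ?env_cons0 ?env_consS.
      by have := far j; case: ifP; lia.
    by case: ifP => /=; lia.
  + move=> i; case: (unliftP ord0 i) => [j|] ->; rewrite ?env_cons0 ?env_consS //.
      by rewrite e'E; have := far j; case: ifP; lia.
    by case: ifP => /=; lia.
Qed.

Lemma degree_steadyS N (u : 'I_(N + n0)) (v : 'I_(N.+1 + n0)) :
  n0 <= u -> v = u.+1 :> nat -> degree (steady N.+1) v = degree (steady N) u.
Proof.
move=> leu vE; rewrite !degree_steady // /base_degree.
have -> : nat_of_ord v = n0 + (u - n0).+1 by lia.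
have -> : nat_of_ord u = n0 + (u - n0) by rewrite subnKC.
by rewrite !ltnNge !leq_addr /= !total_hits_new //; lia.
Qed.

(** Room for the transitory part ([2 * m]), the final open vertices ([2 * m]) and the radius
    [2 * m * 2 ^ k] on either side of the cut. *)
Definition far_time (k : nat) : nat := 4 * m + 2 * (2 * m * 2 ^ k).

(** In both graphs the open vertices are the last [2 * m] ones, all to the right of the cut;
    shifting by one matches their lists. *)
Lemma state_steadyS k :
  state m k (steady (far_time k)) = state m k (steady (far_time k).+1).
Proof.
rewrite /far_time; set N := 4 * m + _; set r := 2 * m * 2 ^ k in N *.
have r_gt0 : 0 < r by rewrite !muln_gt0 m_gt0 expn_gt0.
have shiftE b (e : 'I_b -> 'I_(N + n0)) (e' : 'I_b -> 'I_(N.+1 + n0)) :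
    lists (open_set m (steady N)) e -> (forall i, e' i = (e i).+1 :> nat) ->
    tp (adj (steady N)) k e = tp (adj (steady N.+1)) k e'
    /\ degrees m (steady N) e = degrees m (steady N.+1) e'.
  move=> le e'E; have opn i : n0 + N <= e i + 2 * m.
    by have := lists_in i le; rewrite open_steady // /N; lia.
  split.
    apply: (@tp_steadyS _ _ (n0 + 2 * m + r)); rewrite -/r.
    - by [].
    - by rewrite /N; lia.
    - by move=> i; have := opn i; rewrite /N; lia.
    - by move=> i; rewrite e'E; have := opn i; rewrite /N; lia.
  apply/ffunP => i; rewrite !ffunE; congr inord.
  by apply/esym/degree_steadyS => //; have := opn i; rewrite /N; lia.
have opnE (u : 'I_(N + n0)) :
    (u \in open_set m (steady N)) = (n0 + N <= u + 2 * m).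
  by apply: open_steady; rewrite // /N; lia.
have opnSE (u : 'I_(N.+1 + n0)) :
    (u \in open_set m (steady N.+1)) = (n0 + N.+1 <= u + 2 * m).
  by apply: open_steady; rewrite // /N; lia.
apply/setP => -[t ds]; apply/stateP/stateP => -[e [le /= -> ->]].
  have lt i : (e i).+1 < N.+1 + n0 by rewrite addSn ltnS.
  pose e' i := Ordinal (lt i).
  have [-> ->] := shiftE _ e e' le (fun=> erefl); exists e'; split=> //.
  apply/listsP => y; rewrite opnSE; split=> [ley|[i <-]]; last first.
    by have := lists_in i le; rewrite opnE /=; lia.
  have lty : y.-1 < N + n0 by have := ltn_ord y; lia.
  have /listsP/(_ (Ordinal lty))[+ _] := le.
  rewrite opnE /=; case; first by lia.
  by move=> i ei; exists i; apply: val_inj; rewrite /= ei /=; lia.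
have opn i : n0 + N.+1 <= e i + 2 * m by have := lists_in i le; rewrite opnSE.
have lt i : (e i).-1 < N + n0.
  by have := ltn_ord (e i); have := opn i; rewrite /N; lia.
pose e' i := Ordinal (lt i).
have le' : lists (open_set m (steady N)) e'.
  apply/listsP => y; rewrite opnE; split=> [ley|[i <-]]; last first.
    by have := opn i; rewrite /=; lia.
  have lty : y.+1 < N.+1 + n0 by rewrite addSn ltnS.
  have /listsP/(_ (Ordinal lty))[+ _] := le.
  rewrite opnSE /=; case; first by lia.
  by move=> i ei; exists i; apply: val_inj; rewrite /= ei.
have e'E i : e i = (e' i).+1 :> nat by rewrite /=; have := opn i; rewrite /N; lia.
by have [<- <-] := shiftE _ e' e le' e'E; exists e'.
Qed.

End Steady.

(** * Finite Markov chains *)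

From mathcomp Require Import all_classical all_reals all_analysis.
Import Order.TTheory GRing.Theory Num.Theory.
Import numFieldNormedType.Exports.
Local Open Scope classical_set_scope.
Local Open Scope ring_scope.

Section Stochastic.
Variables (R : realType) (n : nat) (Q : 'M[R]_n).
Hypothesis Q_ge0 : forall i j, 0 <= Q i j.
Hypothesis Q_sum1 : forall i, \sum_j Q i j = 1.

Lemma exp_ge0 N i j : 0 <= (Q ^+ N) i j.
Proof.
elim: N i j => [|N IH] i j; first by rewrite expr0 mxE ler0n.
by rewrite exprS mxE sumr_ge0 // => l _; rewrite mulr_ge0.
Qed.

Lemma exp_sum1 N i : \sum_j (Q ^+ N) i j = 1.
Proof.
elim: N i => [|N IH] i.
  rewrite expr0 (bigD1 i) //= mxE eqxx big1 ?addr0 // => j /negbTE neq.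
  by rewrite mxE eq_sym neq.
rewrite exprS; under eq_bigr do rewrite mxE.
rewrite exchange_big /= -[RHS](Q_sum1 i); apply: eq_bigr => l _.
by rewrite -mulr_sumr IH mulr1.
Qed.

Lemma exp_gt0D N N' i z j :
  0 < (Q ^+ N) i z -> 0 < (Q ^+ N') z j -> 0 < (Q ^+ (N + N')) i j.
Proof.
move=> p1 p2; rewrite exprD mxE (bigD1 z) //=.
by rewrite ltr_pwDl ?mulr_gt0 // sumr_ge0 // => l _; rewrite mulr_ge0 ?exp_ge0.
Qed.

Definition bounded_by (a : R) (f : 'cV[R]_n) : Prop := forall i, `|f i 0| <= a.

(* A sub-stochastic row keeps the bound; the mass [d] at [z] is set apart. *)
Lemma exp_split N a d z (f : 'cV[R]_n) i : bounded_by a f -> 0 <= d <= (Q ^+ N) i z ->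
  `|(Q ^+ N *m f) i 0 - d * f z 0| <= (1 - d) * a.
Proof.
move=> bf /andP[d0 dle].
have -> : (Q ^+ N *m f) i 0 - d * f z 0
    = \sum_j ((Q ^+ N) i j - d *+ (j == z)) * f j 0.
  rewrite mxE; under [RHS]eq_bigr do rewrite mulrBl.
  rewrite sumrB; congr (_ - _); rewrite (bigD1 z) //= eqxx big1 ?addr0 // => j.
  by move=> /negbTE ->; rewrite mul0r.
have w0 j : 0 <= (Q ^+ N) i j - d *+ (j == z).
  by case: eqP => [->|_]; rewrite subr_ge0 // exp_ge0.
apply: le_trans (ler_norm_sum _ _ _) _.
have -> : (1 - d) * a = \sum_j ((Q ^+ N) i j - d *+ (j == z)) * a.
  rewrite -mulr_suml sumrB exp_sum1; congr ((1 - _) * a).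
  by rewrite (bigD1 z) //= eqxx big1 ?addr0 // => j /negbTE ->.
by apply: ler_sum => j _; rewrite normrM ger0_norm // ler_wpM2l.
Qed.

Lemma exp_bounded N a f : bounded_by a f -> bounded_by a (Q ^+ N *m f).
Proof.
move=> bf i; have := @exp_split N a 0 i f i bf.
by rewrite lexx exp_ge0 mul0r subr0 subr0 mul1r; apply.
Qed.

Hypothesis overlap : forall i, exists N z, 0 < (Q ^+ N) i z /\ 0 < (Q ^+ N.+1) i z.

(** Walks from [i] to [z] of lengths [N] to [N + J] are followed by walks from [z] to [z'] of length
    [N'] or [N'.+1], which gains one more length. *)
Lemma long_overlap J i : exists N z, forall l, (l <= J)%N -> 0 < (Q ^+ (N + l)) i z.
Proof.
elim: J => [|J [N [z hz]]].
  have [N [z [h _]]] := overlap i; exists N, z => l.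
  by rewrite leqn0 => /eqP ->; rewrite addn0.
have [N' [z' [h h']]] := overlap z; exists (N + N')%N, z' => l.
rewrite leq_eqVlt ltnS => /orP[/eqP ->|lel].
  rewrite (_ : (_ + _ = (N + J) + N'.+1)%N); first exact: exp_gt0D (hz _ _) h'.
  by rewrite !addnS addnAC.
by rewrite addnAC; apply: exp_gt0D (hz _ _) h.
Qed.

Lemma finite_pos_lower (I : finType) (d : I -> R) :
  (forall i, 0 < d i) -> exists2 e, 0 < e <= 1 & forall i, e <= d i.
Proof.
move=> d0; exists (\big[Num.min/1]_i d i); last first.
  by move=> i; apply: bigmin_le_cond.
by rewrite bigmin_le_id andbT; apply/bigmin_gtP.
Qed.

Lemma uniform_overlap J : exists (N : 'I_n -> nat) (z : 'I_n -> 'I_n) (d : R),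
  0 < d <= 1 /\ forall i l, (l <= J)%N -> d <= (Q ^+ (N i + l)) i (z i).
Proof.
have /choice[N /choice[z hz]] := long_overlap J.
have [|d d01 hd] := @finite_pos_lower ('I_n * 'I_J.+1)%type
    (fun p => (Q ^+ (N p.1 + p.2)) p.1 (z p.1)).
  by move=> [i l]; apply: hz; rewrite -ltnS ltn_ord.
exists N, z, d; split=> // i l; rewrite -ltnS => lel.
exact: hd (i, Ordinal lel).
Qed.

(** For each [l <= J], the value at [x] is [d] times an increment at [z x], up to [(1 - d) * a].
    Summed over [l], these increments telescope to a difference of two values bounded by [b];
    division by [J.+1] gives the bound. *)
Lemma contraction (J : nat) : exists (K : nat) (d : R), 0 < d <= 1 /\
  forall a b (f : 'cV[R]_n), bounded_by b f -> bounded_by a ((Q - 1) *m f) ->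
    bounded_by ((1 - d) * a + d * (2 * b / J.+1%:R)) (Q ^+ K *m ((Q - 1) *m f)).
Proof.
have [N [z [d [d01 hd]]]] := uniform_overlap J.
have [d0 d1] := andP d01.
exists (\sum_i N i + J)%N, d; split=> // a b f bf ba x.
(* The exponent must not depend on the row: [M] is what the sum leaves beyond the time [N x + J]
   needed at [x]. *)
have [M ->] : exists M, (\sum_i N i + J = N x + J + M)%N.
  by exists (\sum_(i < n | i != x) N i)%N; rewrite (bigD1 x) //= addnAC.
set v := (X in `|X| <= _).
pose g t : 'cV[R]_n := Q ^+ (M + t) *m f.
have vE l : (l <= J)%N ->
    `|v - d * (g (J - l).+1 (z x) 0 - g (J - l)%N (z x) 0)| <= (1 - d) * a.
  move=> lel.
  have -> : v = (Q ^+ (N x + l) *m (Q ^+ (M + (J - l)) *m ((Q - 1) *m f))) x 0.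
    rewrite /v !mulmxA -[Q ^+ _ *m Q ^+ _]exprD; congr ((_ *m _ *m _) x 0).
    by congr (_ ^+ _); lia.
  have -> : g (J - l).+1 (z x) 0 - g (J - l)%N (z x) 0
      = (Q ^+ (M + (J - l)) *m ((Q - 1) *m f)) (z x) 0.
    rewrite /g addnS exprSr !mulmxBl mul1mx mulmxBr mulmxA.
    by rewrite [RHS]mxE [X in _ = _ + X]mxE.
  apply: exp_split; last by rewrite ltW // hd.
  exact: exp_bounded.
have tel : \sum_(l < J.+1) (g (J - l).+1 (z x) 0 - g (J - l)%N (z x) 0)
    = g J.+1 (z x) 0 - g 0%N (z x) 0.
  rewrite -(big_mkord predT (fun l => g (J - l).+1 (z x) 0 - g (J - l)%N (z x) 0)).
  rewrite big_nat_rev /= add0n.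
  rewrite (eq_big_nat _ _ (F2 := fun l => g l.+1 (z x) 0 - g l (z x) 0)).
    by rewrite telescope_sumr.
  by move=> l /andP[_ lel]; rewrite subSS subKn.
have bg t : `|g t (z x) 0| <= b by apply: exp_bounded.
have J0 : 0 < J.+1%:R :> R by rewrite ltr0n.
have : `|v *+ J.+1 - d * (g J.+1 (z x) 0 - g 0%N (z x) 0)| <= ((1 - d) * a) *+ J.+1.
  rewrite -tel mulr_sumr -[X in v *+ X]card_ord -sumr_const -sumrB.
  rewrite -[X in _ <= _ *+ X]card_ord -sumr_const.
  apply: le_trans (ler_norm_sum _ _ _) _.
  by apply: ler_sum => l _; apply: vE; rewrite -ltnS.
rewrite -[v *+ _]mulr_natr -[_ * a *+ _]mulr_natr => hv.
have hg : `|d * (g J.+1 (z x) 0 - g 0%N (z x) 0)| <= d * (2 * b).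
  rewrite normrM (gtr0_norm d0) ler_wpM2l ?(ltW d0) //.
  by apply: le_trans (ler_normB _ _) _; rewrite mulrDl mul1r lerD.
rewrite -(ler_pM2r J0) mulrDl.
have -> : d * (2 * b / J.+1%:R) * J.+1%:R = d * (2 * b).
  by rewrite -!mulrA mulVf ?mulr1 // gt_eqF.
rewrite -{1}(gtr0_norm J0) -normrM.
set w := d * (_ - _) in hv hg.
rewrite -(subrK w (v * _)); apply: le_trans (ler_normD _ _) _.
exact: lerD.
Qed.

Lemma increment_comm t : (Q - 1) *m Q ^+ t = Q ^+ t *m (Q - 1).
Proof. by rewrite mulmxBl mulmxBr mul1mx mulmx1 -[Q *m _]exprS -[_ *m Q]exprSr. Qed.

Lemma exp_shift (K M : nat) (f : 'cV[R]_n) :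
  Q ^+ (K + M) *m ((Q - 1) *m f) = Q ^+ K *m ((Q - 1) *m (Q ^+ M *m f)).
Proof. by rewrite exprD -mulmxA [X in _ = _ *m X]mulmxA increment_comm -!mulmxA. Qed.

Lemma increments_small (f : 'cV[R]_n) (e : R) : 0 < e ->
  exists N, forall t, (N <= t)%N -> bounded_by e (Q ^+ t *m ((Q - 1) *m f)).
Proof.
move=> e0.
pose b : R := 1 + \sum_i `|f i 0|.
have b0 : 0 < b by rewrite ltr_pwDl // sumr_ge0.
have bf : bounded_by b f.
  move=> i; rewrite /b (bigD1 i) //= addrCA lerDl addr_ge0 // sumr_ge0 //.
(* This makes the additive term of the contraction at most [d * (e / 2)], so that [e / 2] is kept by
   the iteration while the rest shrinks by the factor [1 - d]. *)
pose J := Num.truncn (4 * b / e).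
have J0 : 0 < J.+1%:R :> R by rewrite ltr0n.
have hJ : 2 * b / J.+1%:R <= e / 2.
  have := Num.Theory.truncnS_gt (4 * b / e); rewrite -/J ltr_pdivrMr // => h.
  by rewrite ler_pdivrMr //; nra.
have [K [d [/andP[d0 d1] contr]]] := contraction J.
have iterK T : bounded_by ((1 - d) ^+ T * (2 * b) + e / 2)
    (Q ^+ (K * T) *m ((Q - 1) *m f)).
  elim: T => [|T IH].
    rewrite muln0 !expr0 mul1mx mul1r mulmxBl mul1mx => i.
    rewrite !mxE; apply: le_trans (ler_normB _ _) _.
    have := @exp_bounded 1 b f bf i; rewrite expr1 mxE => h1; have := bf i.
    by lra.
  have -> : Q ^+ (K * T.+1) *m ((Q - 1) *m f)
      = Q ^+ K *m ((Q - 1) *m (Q ^+ (K * T) *m f)).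
    by rewrite mulnS exp_shift.
  have bfT : bounded_by b (Q ^+ (K * T) *m f) by apply: exp_bounded.
  have IH' : bounded_by ((1 - d) ^+ T * (2 * b) + e / 2)
      ((Q - 1) *m (Q ^+ (K * T) *m f)).
    by have := exp_shift 0 (K * T) f; rewrite add0n expr0 mul1mx => <-.
  move=> i; apply: le_trans (contr _ _ _ bfT IH' i) _.
  have := ler_wpM2l (ltW d0) hJ; rewrite exprS.
  by move: (2 * b / _) ((1 - d) ^+ T * (2 * b)) (_ ^+ T) => q r s; lra.
have [T hT] : exists T, (1 - d) ^+ T * (2 * b) <= e / 2.
  have lim : (1 - d) ^+ T * (2 * b) @[T --> \oo] --> (0 * (2 * b)).
    apply: cvgMl; apply: cvg_expr; rewrite ger0_norm ?subr_ge0 //; lra.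
  rewrite mul0r in lim.
  have /cvgrPdist_le/(_ (e / 2)) := lim.
  rewrite divr_gt0 // => /(_ isT)[T _ hT]; exists T.
  have := hT T (leqnn T); rewrite /= sub0r normrN.
  exact: le_trans (ler_norm _).
exists (K * T)%N => t leT.
move=> i; rewrite -(subnK leT) exprD -mulmxA.
apply: exp_bounded => {}i; apply: le_trans (iterK T i) _; lra.
Qed.

(** Such a [v] is fixed by [Q], so it equals [u *m Q ^+ t *m (Q - 1)] for every [t], and these tend
    to 0. *)
Lemma kernel_image_trivial (v u : 'rV[R]_n) :
  v *m (Q - 1) = 0 -> v = u *m (Q - 1) -> v = 0.
Proof.
move=> v0 vE; have vQ t : v *m Q ^+ t = v.
  elim: t => [|t IH]; first by rewrite expr0 mulmx1.
  rewrite exprS mulmxA; move: v0; rewrite mulmxBr mulmx1 => /eqP.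
  by rewrite subr_eq0 => /eqP ->.
apply/rowP => j; rewrite [RHS]mxE; apply/eqP; rewrite -normr_le0.
apply/ler_addgt0Pr => e e0; rewrite add0r.
pose c : R := 1 + \sum_i `|u 0 i|.
have c0 : 0 < c by rewrite ltr_pwDl // sumr_ge0.
have [T hT] := @increments_small (delta_mx j 0) (e / c) (divr_gt0 e0 c0).
have -> : v 0 j = (u *m (Q ^+ T *m ((Q - 1) *m (delta_mx j 0 : 'cV_n)))) 0 0.
  rewrite -(vQ T) vE -!mulmxA.
  rewrite [_ *m Q ^+ T]increment_comm.
  by rewrite !mulmxA -colE [RHS]mxE.
rewrite mxE; apply: le_trans (ler_norm_sum _ _ _) _.
apply: le_trans (_ : \sum_i `|u 0 i| * (e / c) <= _).
  by apply: ler_sum => i _; rewrite normrM ler_wpM2l // hT.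
by rewrite -mulr_suml mulrCA ger_pMr // ler_pdivrMr // mul1r /c lerDr.
Qed.

Lemma chain_cvg (mu : 'rV[R]_n) (f : 'cV[R]_n) :
  exists l : R, (mu *m Q ^+ t *m f) 0 0 @[t --> \oo] --> l.
Proof.
pose A := Q - 1.
have cap0 : (kermx A :&: A)%MS = 0.
  apply/eqP; rewrite -submx0; apply/row_subP => i.
  have /submxP[u uE] : (row i (kermx A :&: A) <= A)%MS.
    by rewrite (submx_trans (row_sub _ _)) // capmxSr.
  have /sub_kermxP ker : (row i (kermx A :&: A) <= kermx A)%MS.
    by rewrite (submx_trans (row_sub _ _)) // capmxSl.
  by rewrite (kernel_image_trivial ker uE) sub0mx.
(* By rank-nullity, the trivial intersection makes the sum the whole space. The component of [mu] in
   the kernel gives the limit, the one in the image dies out. *)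
have full : row_full (kermx A + A)%MS.
  have := mxrank_sum_cap (kermx A) A; rewrite cap0 mxrank0 addn0 mxrank_ker.
  by rewrite subnK ?rank_leq_row // => h; apply/eqP.
have /sub_addsmxP[[u w] /= muE] := submx_full mu full.
have fix0 t : u *m kermx A *m Q ^+ t = u *m kermx A.
  elim: t => [|t IH]; first by rewrite expr0 mulmx1.
  rewrite exprS mulmxA; suff -> : u *m kermx A *m Q = u *m kermx A by [].
  have : u *m kermx A *m A = 0 by rewrite -mulmxA mulmx_ker mulmx0.
  by rewrite /A mulmxBr mulmx1 => /eqP; rewrite subr_eq0 => /eqP.
exists ((u *m kermx A *m f) 0 0).
apply/cvgrPdist_le => e e0.
pose c : R := 1 + \sum_i `|w 0 i|.
have c0 : 0 < c by rewrite ltr_pwDl // sumr_ge0.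
have [T hT] := @increments_small f (e / c) (divr_gt0 e0 c0).
exists T => // t /= leTt.
have -> : (mu *m Q ^+ t *m f) 0 0
    = (u *m kermx A *m f) 0 0 + (w *m (Q ^+ t *m ((Q - 1) *m f))) 0 0.
  rewrite muE mulmxDl fix0 mulmxDl mxE; congr (_ + _).
  by rewrite -[w *m A *m _]mulmxA increment_comm -!mulmxA.
rewrite opprD addNKr normrN mxE; apply: le_trans (ler_norm_sum _ _ _) _.
apply: le_trans (_ : \sum_i `|w 0 i| * (e / c) <= _).
  by apply: ler_sum => i _; rewrite normrM ler_wpM2l // hT.
by rewrite -mulr_suml mulrCA ger_pMr // ler_pdivrMr // mul1r /c lerDr.
Qed.

End Stochastic.

(** * The law of the process *)

Section StateChain.
Variables (R : realType) (m k : nat).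
Hypothesis m_gt0 : (0 < m)%N.

Definition realizes (x : state_type m k) (G : {n & sgraph n}) : Prop :=
  valid m (projT2 G) /\ state m k (projT2 G) = x.

(** The graph picked to represent [x] does not matter, by lumpability. States of no valid graph are
    made absorbing, which keeps the matrix stochastic and gives them the overlap for free. *)
Definition transition (x y : state_type m k) : R :=
  match pselect (exists G, realizes x G) with
  | left ex => let G := projT2 (projT1 (cid ex)) in
      #|choices_to G y|%:R / #|choices m (2 * m) G|%:R
  | right _ => (x == y)%:R
  end.

Lemma transitionE n (G : sgraph n) y : valid m G ->
  transition (state m k G) y = #|choices_to G y|%:R / #|choices m (2 * m) G|%:R.
Proof.
move=> vG; rewrite /transition; case: pselect => [ex|[]]; last first.
  by exists (existT sgraph n G).
case: (cid ex) => -[n' H] /= [/= vH eqs].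
by rewrite (choices_state_eq _ m_gt0 vH vG eqs)
  (card_choices_state_eq m_gt0 vH vG eqs).
Qed.

Lemma transition_ge0 x y : 0 <= transition x y.
Proof. by rewrite /transition; case: pselect => // ex; rewrite divr_ge0. Qed.

Lemma transition_sum1 x : \sum_y transition x y = 1.
Proof.
rewrite /transition; case: pselect => [ex|_].
  case: (cid ex) => -[n G] /= [/= vG _].
  rewrite -mulr_suml -natr_sum card_choices_sum divff //.
  by rewrite pnatr_eq0 -lt0n card_choices_gt0.
by rewrite (bigD1 x) //= eqxx big1 ?addr0 // => y /negbTE; rewrite eq_sym => ->.
Qed.

Lemma transition_attach n (G : sgraph n) S :
  valid m G -> S \in choices m (2 * m) G ->
  0 < transition (state m k G) (state m k (attach G S)).
Proof.
move=> vG chS; rewrite transitionE // divr_gt0 ?ltr0n ?card_choices_gt0 //.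
by apply/card_gt0P; exists S; rewrite inE chS eqxx.
Qed.

Definition transition_mx : 'M[R]_#|state_type m k| :=
  \matrix_(i, j) transition (enum_val i) (enum_val j).

Lemma transition_mx_ge0 i j : 0 <= transition_mx i j.
Proof. by rewrite mxE transition_ge0. Qed.

Lemma transition_mx_sum1 i : \sum_j transition_mx i j = 1.
Proof.
rewrite -[RHS](transition_sum1 (enum_val i)).
under eq_bigr do rewrite mxE.
by rewrite [RHS](reindex _ (onW_bij _ (enum_val_bij _))).
Qed.

Lemma transition_steady n (G : sgraph n) t : valid m G ->
  0 < (transition_mx ^+ t) (enum_rank (state m k G))
                           (enum_rank (state m k (steady m G t))).
Proof.
move=> vG; elim: t => [|t IH]; first by rewrite expr0 mxE eqxx ltr01.
have step : 0 < (transition_mx ^+ 1) (enum_rank (state m k (steady m G t)))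
                           (enum_rank (state m k (steady m G t.+1))).
  rewrite expr1 mxE !enum_rankK /=; apply: transition_attach.
    exact: valid_steady.
  exact: steady_choice.
by have := exp_gt0D (@transition_mx_ge0) IH step; rewrite [X in _ ^+ X]addn1.
Qed.

Lemma transition_overlap i : exists N z,
  0 < (transition_mx ^+ N) i z /\ 0 < (transition_mx ^+ N.+1) i z.
Proof.
have [[[n G] [/= vG st]]|nex] := pselect (exists G, realizes (enum_val i) G).
  have iE : i = enum_rank (state m k G) by rewrite st enum_valK.
  exists (far_time m k), (enum_rank (state m k (steady m G (far_time m k)))).
  rewrite iE; split; first exact: transition_steady.
  by rewrite state_steadyS //; apply: transition_steady.
exists 0%N, i; rewrite expr0 expr1 !mxE eqxx ltr01; split=> //.
by rewrite /transition; case: pselect => // _; rewrite eqxx ltr01.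
Qed.

End StateChain.

(** * Real-valued probabilities and finite partitions *)

Section Probability.
Variables (R : realType) (d : measure_display) (T : measurableType d).
Variable P : probability T R.

Definition pr (A : set T) : R := fine (P A).

Lemma prE A : measurable A -> P A = (pr A)%:E.
Proof. by move=> mA; rewrite fineK // fin_num_measure. Qed.

Lemma pr_ge0 A : 0 <= pr A.
Proof. by rewrite fine_ge0. Qed.

Lemma pr0 : pr set0 = 0.
Proof. by rewrite /pr measure0. Qed.

Lemma prT : pr setT = 1.
Proof. by rewrite /pr probability_setT. Qed.

Lemma prU A B : measurable A -> measurable B -> A `&` B = set0 ->
  pr (A `|` B) = pr A + pr B.
Proof.
move=> mA mB dAB; rewrite /pr measureU // fineD ?fin_num_measure //.
Qed.

Lemma pr_partition (I : finType) (X : T -> I) B : measurable B ->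
  (forall i, measurable [set w | X w = i]) ->
  pr B = \sum_i pr (B `&` [set w | X w = i]).
Proof.
move=> mB mX.
suff H (s : seq I) : uniq s ->
    measurable (B `&` [set w | X w \in s]) /\
    pr (B `&` [set w | X w \in s]) = \sum_(i <- s) pr (B `&` [set w | X w = i]).
  have [_ <-] := H (index_enum I) (index_enum_uniq I).
  congr pr; apply/seteqP; split=> [w Bw|w []//]; split=> //=.
  by rewrite mem_index_enum.
elim: s => [_|i s IH /= /andP[nis /IH[ms prs]]].
  rewrite (_ : _ `&` _ = set0) ?big_nil ?pr0; first by split.
  by rewrite -subset0 => w [].
have -> : B `&` [set w | X w \in i :: s]
    = (B `&` [set w | X w = i]) `|` (B `&` [set w | X w \in s]).
  apply/seteqP; split=> w /=.
    by rewrite in_cons => -[Bw /orP[/eqP ?|?]]; [left | right].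
  by rewrite in_cons => -[] [Bw h]; split=> //; rewrite h ?eqxx ?orbT.
have mi : measurable (B `&` [set w | X w = i]) by apply: measurableI.
split; first exact: measurableU.
rewrite prU // ?prs ?big_cons //.
by rewrite -subset0 => w /= [[_ ->] [_ h]]; move: nis; rewrite h.
Qed.

End Probability.

(** * From the conditional description to a Markov chain *)

Section Process.
Variables (R : realType) (d : measure_display) (T : measurableType d).
Variables (P : probability T R) (m : nat) (G : forall n : nat, T -> sgraph n).
Hypotheses (m_gt0 : (0 < m)%N) (HG : uniform_attachment P G m (2 * m)%N).

Definition recent (l n : nat) (g : forall i, sgraph i) : set T :=
  [set w | forall i : nat, (l < i <= n)%N -> G i w = g i].

Lemma measurable_graph n (g : sgraph n) : (m < n)%N -> measurable [set w | G n w = g].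
Proof. exact: (ua_measurable HG). Qed.

Lemma measurable_recent l n g : (m <= l)%N -> measurable (recent l n g).
Proof.
move=> lel; rewrite (_ : recent l n g =
    \bigcap_(i in [set i | (l < i <= n)%N]) [set w | G i w = g i]); last first.
  by apply/seteqP; split=> w h i; exact: h.
by apply: bigcap_measurableType => i /andP[lt _]; apply/measurable_graph/(leq_ltn_trans lel).
Qed.

Lemma recent_step l n g S : (m <= l < n)%N -> S \in choices m (2 * m) (g n) ->
  pr P (recent l n g `&` [set w | G n.+1 w = attach (g n) S])
    = pr P (recent l n g) / #|choices m (2 * m) (g n)|%:R.
Proof.
move=> /andP[/subnK <-]; move: (l - m)%N => {}l.
elim: l g => [|l IH] g ltn chS.
  by rewrite /pr (ua_step HG) // fineM // fin_num_measure //; apply: measurable_recent.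
have ltlm : (m < l.+1 + m)%N by rewrite addSn ltnS leq_addl.
have mH : measurable (recent (l.+1 + m) n g) by apply/measurable_recent/ltnW.
have mS : measurable [set w | G n.+1 w = attach (g n) S].
  by apply: measurable_graph; lia.
have mX h : measurable [set w | G (l.+1 + m) w = h] by apply: measurable_graph.
rewrite (pr_partition P (X := G (l.+1 + m)%N)) //; last exact: measurableI.
rewrite [in RHS](pr_partition P (X := G (l.+1 + m)%N)) // mulr_suml.
apply: eq_bigr => h _; pose g' := dfwith g (l.+1 + m)%N h.
have g'n : g' n = g n by rewrite /g' dfwithout // lt_eqF.
have recE : recent (l.+1 + m) n g `&` [set w | G (l.+1 + m)%N w = h]
    = recent (l + m) n g'.
  apply/seteqP; split=> [w [hw hh] i /andP[lti lei]|w hw].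
    rewrite /g'; have [eqi|neq] := eqVneq (l.+1 + m)%N i.
      by case: i / eqi lti lei; rewrite dfwithin.
    by rewrite dfwithout // hw // lei andbT ltn_neqAle neq.
  split=> [i /andP[lti lei]|] /=.
    rewrite hw; last by rewrite lei andbT; apply: leq_trans lti; rewrite addSn.
    by rewrite /g' dfwithout // lt_eqF.
  by rewrite hw /g' ?dfwithin //; apply/andP; split; lia.
rewrite setIAC recE -g'n; apply: IH; last by rewrite g'n.
by apply: leq_trans ltn; rewrite addSn.
Qed.

Lemma graph_step n (g : sgraph n) S : (m < n)%N -> S \in choices m (2 * m) g ->
  pr P ([set w | G n w = g] `&` [set w | G n.+1 w = attach g S])
    = pr P [set w | G n w = g] / #|choices m (2 * m) g|%:R.
Proof.
case: n g S => // n g S ltn chS.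
pose g' := dfwith (fun i => complete_graph i) n.+1 g.
have g'n : g' n.+1 = g by rewrite /g' dfwithin.
have <- : recent n n.+1 g' = [set w | G n.+1 w = g].
  apply/seteqP; split=> [w /(_ n.+1)|w hw i /andP[lti lei]].
    by rewrite g'n; apply; rewrite !leqnn.
  have eqi : n.+1 = i by apply/eqP; rewrite eqn_leq lei lti.
  by case: i / eqi lti lei; rewrite g'n.
rewrite -g'n; apply: recent_step; rewrite ?g'n //.
by rewrite ltnSn -ltnS ltn.
Qed.

Definition law n (g : sgraph n) : R := pr P [set w | G n w = g].

Lemma law_sum1 n : (m < n)%N -> \sum_g law (g : sgraph n) = 1.
Proof.
move=> ltn; rewrite -(prT P) (pr_partition P (X := G n)) //.
  by apply: eq_bigr => g _; rewrite setTI.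
by move=> g; apply: measurable_graph.
Qed.

Definition kernel n (g : sgraph n) (h : sgraph n.+1) : R :=
  (\sum_(S in choices m (2 * m) g) (attach g S == h)%:R)
    / #|choices m (2 * m) g|%:R.

Lemma kernel_sum1 n (g : sgraph n) : valid m g -> \sum_h kernel g h = 1.
Proof.
move=> vg; rewrite -mulr_suml exchange_big /=.
rewrite (eq_bigr (fun=> 1)) => [|S _].
  by rewrite sumr_const divff // pnatr_eq0 -lt0n card_choices_gt0.
by rewrite (bigD1 (attach g S)) //= eqxx big1 ?addr0 // => h /negbTE; rewrite eq_sym => ->.
Qed.

(* Each summand of [law h] is at least that of the kernel, and both sides have
   the same total mass. *)
Lemma law_step n (h : sgraph n.+1) : (m < n)%N ->
  (forall g : sgraph n, ~~ valid m g -> law g = 0) ->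
  law h = \sum_(g : sgraph n) law g * kernel g h.
Proof.
move=> ltn law0.
pose joint (g : sgraph n) (h : sgraph n.+1) :=
  pr P ([set w | G n w = g] `&` [set w | G n.+1 w = h]).
have mn g : measurable [set w | G n w = g] by apply: measurable_graph.
have mSn h' : measurable [set w | G n.+1 w = h'].
  by apply: measurable_graph; apply: leqW.
have lawE h' : law h' = \sum_g joint g h'.
  rewrite /law (pr_partition P (X := G n)) //.
  by apply: eq_bigr => g _; rewrite setIC.
have joint_ge (g : sgraph n) h' : law g * kernel g h' <= joint g h'.
  have [[S chS hS]|nex] := pselect (exists2 S, S \in choices m (2 * m) g & h' = attach g S).
    rewrite /joint hS graph_step // /kernel mulrA ler_wpM2r ?invr_ge0 //.
    rewrite -[leRHS]mulr1 ler_wpM2l ?pr_ge0 //.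
    rewrite (bigD1 S) //= eqxx big1 ?addr0 // => S' /andP[_ neq].
    by rewrite (inj_eq (@attach_inj _ g)) (negbTE neq).
  rewrite /kernel big1 ?mul0r ?mulr0 ?pr_ge0 // => S chS.
  by case: eqP => // hS; case: nex; exists S.
have total : \sum_(h' : sgraph n.+1) (law h' - \sum_(g : sgraph n) law g * kernel g h') = 0.
  rewrite sumrB law_sum1 ?leqW // exchange_big /= -(law_sum1 ltn).
  rewrite -sumrB big1 // => g _; rewrite -mulr_sumr.
  (* Only a valid graph is sure to have a choice, so that its kernel has mass 1; the others have
     probability 0. *)
  have [vg|nvg] := boolP (valid m g); first by rewrite kernel_sum1 // mulr1 subrr.
  by rewrite law0 // mul0r subrr.
have diff_ge0 (h' : sgraph n.+1) : 0 <= law h' - \sum_(g : sgraph n) law g * kernel g h'.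
  by rewrite lawE -sumrB sumr_ge0 // => g _; rewrite subr_ge0.
apply/eqP; rewrite -subr_eq0.
have /eqP := total; rewrite psumr_eq0 // => /allP/(_ h).
by rewrite mem_index_enum => /(_ isT).
Qed.

(** Induction on time: the statement at time [n] is the very hypothesis under which [law_step]
    computes the law at time [n.+1]. *)
Lemma law_valid n (g : sgraph n) : (m < n)%N -> ~~ valid m g -> law g = 0.
Proof.
move=> ltn; move: g; rewrite -(subnK ltn); move: (n - m.+1)%N => t.
elim: t => [|t IH] g nvg.
  rewrite /law (_ : [set w | _] = set0) ?pr0 // -subset0 => w /= gE.
  have eqg : g = complete_graph m.+1 by rewrite -gE; exact: (ua_start HG w).
  by move: nvg; rewrite eqg (valid_complete m).
rewrite law_step; [|by rewrite leq_addl|exact: IH].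
apply: big1 => g' _; have [vg|/IH ->] := boolP (valid m g'); last by rewrite mul0r.
rewrite /kernel big1 ?mul0r ?mulr0 // => S chS; case: eqP => // gE.
by move: nvg; rewrite -gE valid_attach.
Qed.

Section StateLaw.
Variable k : nat.
Local Notation X := (state_type m k).

Definition state_law (n : nat) : 'rV[R]_#|X| :=
  \row_i \sum_(g : sgraph n | state m k g == enum_val i) law g.

Lemma sum_kernel_state n (g : sgraph n) (y : X) :
  \sum_(h | state m k h == y) kernel g h
    = #|choices_to g y|%:R / #|choices m (2 * m) g|%:R.
Proof.
rewrite -mulr_suml; congr (_ / _); rewrite exchange_big /=.
rewrite -sum1_card natr_sum big_mkcond [RHS]big_mkcond /=.
apply: eq_bigr => S _; rewrite [S \in choices_to g y]inE.
case: (S \in choices m (2 * m) g) => //=.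
rewrite big_mkcond (bigD1 (attach g S)) //= eqxx big1 ?addr0; first by case: ifP.
by move=> h /negbTE; rewrite eq_sym => ->; case: ifP.
Qed.

(** Each graph contributes to the single index of its state, and its kernel summed over a state is
    the transition probability. *)
Lemma state_law_step n : (m < n)%N ->
  state_law n.+1 = state_law n *m transition_mx R m k.
Proof.
move=> ltn; apply/rowP => j; rewrite !mxE.
under eq_bigr do rewrite (law_step _ ltn (fun g => law_valid ltn)).
rewrite exchange_big /=.
under [RHS]eq_bigr do rewrite !mxE mulr_suml big_mkcond.
rewrite [RHS]exchange_big /=; apply: eq_bigr => g _.
rewrite -mulr_sumr sum_kernel_state (bigD1 (enum_rank (state m k g))) //=.
rewrite enum_rankK eqxx big1 ?addr0 => [|i neq].
  have [vg|/(law_valid ltn) ->] := boolP (valid m g); last by rewrite !mul0r.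
  by rewrite transitionE.
by case: eqP => // eqs; move: neq; rewrite eqs enum_valK eqxx.
Qed.

Lemma state_law_exp t : state_law (t + m.+1) = state_law m.+1 *m transition_mx R m k ^+ t.
Proof.
elim: t => [|t IH]; first by rewrite expr0 mulmx1.
by rewrite addSn state_law_step ?leq_addl // IH exprSr mulmxA.
Qed.

Variable phi : sentence.
Hypothesis phi_rank : (qrank phi <= k)%N.

Definition state_truth : 'cV[R]_#|X| :=
  \col_i `[< exists G, realizes (enum_val i) G /\ models (projT2 G) phi >]%:R.

Lemma state_truthE n (g : sgraph n) : valid m g ->
  state_truth (enum_rank (state m k g)) 0 = `[< models g phi >]%:R.
Proof.
move=> vg; rewrite mxE enum_rankK; congr (_%:R); congr nat_of_bool.
apply/asbool_equiv_eq; split=> [[[n' h] [[/= vh eqs]]]|mg].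
    exact: (iffLR (state_models m_gt0 vh phi_rank eqs)).
by exists (existT sgraph n g).
Qed.

Lemma pr_models n : (m < n)%N ->
  P [set w | models (G n w) phi] = ((state_law n *m state_truth) 0 0)%:E.
Proof.
move=> ltn; have mG g : measurable [set w | G n w = g] by apply: measurable_graph.
have mM : measurable [set w | models (G n w) phi].
  rewrite (_ : [set w | _] = \bigcup_(g in [set g | models g phi]) [set w | G n w = g]).
    by apply: fin_bigcup_measurable => //; apply: finite_finset.
  apply/seteqP; split=> [w mw|w [g mg /= ->]//]; by exists (G n w).
rewrite prE //; congr EFin; rewrite (pr_partition P (X := G n)) // mxE.
under [RHS]eq_bigr do rewrite [X in X * _]mxE mulr_suml big_mkcond.
rewrite [RHS]exchange_big /=; apply: eq_bigr => g _.
rewrite (bigD1 (enum_rank (state m k g))) //= enum_rankK eqxx big1 ?addr0 => [|i neq].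
  have [vg|nvg] := boolP (valid m g); last first.
    have -> : law g = 0 by apply: law_valid.
    (* The value of [state_truth] says nothing about an invalid graph, but the event has probability
       at most [law g = 0]. *)
    rewrite mul0r; apply/eqP; rewrite eq_le pr_ge0 andbT -(law_valid ltn nvg).
    rewrite /law /pr fine_le ?fin_num_measure //; first exact: measurableI.
    by apply: le_measure; rewrite ?inE; [exact: measurableI | exact: mG | move=> w []].
  rewrite state_truthE //; case: asboolP => mg.
    rewrite mulr1; congr pr; apply/seteqP; split=> [w []//|w /= gw].
    by rewrite gw.
  rewrite mulr0 (_ : _ `&` _ = set0) ?pr0 // -subset0 => w [/= mw gw].
  by apply: mg; rewrite -gw.
by case: eqP => // eqs; move: neq; rewrite eqs enum_valK eqxx.
Qed.

End StateLaw.
End Process.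

Theorem theorem1p2 (R : realType) (disp : measure_display)
    (T : measurableType disp) (P : probability T R) (m : nat)
    (G : forall n : nat, T -> sgraph n) (m_gt1 : (1 < m)%N)
    (HG : uniform_attachment P G m (2 * m)%N) (phi : sentence) :
  exists p : R, P [set w | models (G n w) phi] @[n --> \oo] --> p%:E.
Proof.
have m_gt0 : (0 < m)%N by apply: ltnW.
pose k := qrank phi.
have [p cvp] := chain_cvg (@transition_mx_ge0 R m k)
  (@transition_mx_sum1 R m k m_gt0) (@transition_overlap R m k m_gt0)
  (state_law P m G k m.+1) (state_truth R m k phi).
(* The chain starts at time [m.+1], and a shift of the index does not affect the limit. *)
exists p; rewrite -(cvg_shiftn m.+1) /=.
rewrite (_ : (fun n => _) = EFin \o
    (fun t => (state_law P m G k m.+1 *m transition_mx R m k ^+ t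
      *m state_truth R m k phi) 0 0)); last first.
  apply/funext => t /=; rewrite (pr_models m_gt0 HG (leqnn k)) ?leq_addl //.
  by rewrite (state_law_exp m_gt0 HG).
by apply: cvg_EFin; [exact: nearW | exact: cvp].
Qed.
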